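(* Let $\alpha,a,b>0$. There are constants $C,C'>0$ (depending only on $\alpha,a,b$) such that the following holds. For each $n$, let $X=(\xi_1,\dots,\xi_n)$ be a random vector in $\mathbb{C}^n$ whose coordinates $\xi_i$ are independent random variables with mean $0$ and variance $1$ that are sub-exponential with exponent $\alpha$ and accompanying constants $a,b$. Let $A=A_n\in\mathbb{C}^{n\times n}$ be nonzero deterministic matrices and let $t=t_n>0$ satisfy $$t=\omega\left((\|A\|_F+\log^{\alpha}n\,\|A\|_2)\log^{\alpha+1}n\right)\quad\text{as } n\to\infty.$$ Then for all sufficiently large $n$, $$\mathbf{P}(|X^*AX-\operatorname{trace}(A)|\ge t)\le C\exp\left(-C'\min\left\{\left(\frac{t}{\|A\|_F\sqrt{\log n}}\right)^{\frac{1}{\alpha+1/2}},\left(\frac{t}{\|A\|_2}\right)^{\frac{1}{2\alpha+1}}\right\}\right).$$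
   Context: $\|A\|_F$ and $\|A\|_2$ denote the Frobenius norm and the spectral (operator) norm of $A$. A random variable $\xi$ is sub-exponential with exponent $\alpha>0$ and accompanying constants $a,b>0$ if for any $t>0$, $\mathbf{P}(|\xi-\mathbf{E}\xi|\ge t^{\alpha})\le a\exp(-bt)$. The variance of a complex random variable $\xi$ is $\mathbf{E}|\xi-\mathbf{E}\xi|^2$. The notation $f=\omega(g)$ means $f(n)/g(n)\to\infty$ as $n\to\infty$. *)

(* Defs.v *)
From HB Require Import structures.
From mathcomp Require Import all_boot all_order all_algebra.
From mathcomp Require Import complex.
From mathcomp Require Import all_classical all_reals all_analysis.
Import Order.TTheory GRing.Theory Num.Theory.
Import numFieldNormedType.Exports.
Import ComplexField.Normc.

Set Implicit Arguments.
Unset Strict Implicit.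
Unset Printing Implicit Defensive.

Local Open Scope classical_set_scope.
Local Open Scope ring_scope.
Local Open Scope complex_scope.

(* The Borel structure of the complex plane is that of the product R * R. *)
Definition complex_pair (R : realType) (z : R[i]) : R * R :=
  (complex.Re z, complex.Im z).

Definition complex_rv d (T : measurableType d) (R : realType)
    (xi : T -> R[i]) : Prop :=
  measurable_fun setT (fun w => complex_pair (xi w)).

Definition complex_integrable d (T : measurableType d) (R : realType)
    (P : probability T R) (xi : T -> R[i]) : Prop :=
  P.-integrable setT (fun w => (complex.Re (xi w))%:E) /\
  P.-integrable setT (fun w => (complex.Im (xi w))%:E).

(* Meaningful under complex_integrable only: fine sends infinite values to 0. *)
Definition complex_expectation d (T : measurableType d) (R : realType)
    (P : probability T R) (xi : T -> R[i]) : R[i] :=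
  fine 'E_P[fun w => complex.Re (xi w)]%E +i*
  fine 'E_P[fun w => complex.Im (xi w)]%E.

Definition complex_variance d (T : measurableType d) (R : realType)
    (P : probability T R) (xi : T -> R[i]) : \bar R :=
  'E_P[fun w => (normc (xi w - complex_expectation P xi) ^+ 2)%R]%E.

Definition sub_exponential d (T : measurableType d) (R : realType)
    (P : probability T R) (alpha a b : R) (xi : T -> R[i]) : Prop :=
  forall t : R, 0 < t ->
    (P [set w | (t `^ alpha <= normc (xi w - complex_expectation P xi))%R]
      <= (a * expR (- (b * t)))%:E)%E.

Definition mutually_independent d (T : measurableType d) (R : realType)
    (P : probability T R) (I : finType) d' (S : measurableType d')
    (Y : I -> T -> S) : Prop :=
  forall (J : {set I}) (B : I -> set S), (forall i, measurable (B i)) ->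
    (P (\bigcap_(i in [set` J]) (Y i @^-1` B i))
      = \prod_(i in J) P (Y i @^-1` B i))%E.

Definition euclidean_norm (R : realType) n (v : 'cV[R[i]]_n) : R :=
  Num.sqrt (\sum_(i < n) normc (v i 0) ^+ 2).

Definition frobenius_norm (R : realType) m n (A : 'M[R[i]]_(m, n)) : R :=
  Num.sqrt (\sum_(i < m) \sum_(j < n) normc (A i j) ^+ 2).

Definition spectral_norm (R : realType) m n (A : 'M[R[i]]_(m, n)) : R :=
  sup [set euclidean_norm (A *m v) |
        v in [set v : 'cV[R[i]]_n | euclidean_norm v <= 1]].

Definition quadratic_form (R : realType) n (A : 'M[R[i]]_n)
    (x : 'cV[R[i]]_n) : R[i] :=
  (map_mx Num.conj x^T *m A *m x) 0 0.

Definition little_omega (R : realType) (f g : nat -> R) : Prop :=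
  f n / g n @[n --> \oo] --> +oo.

(* Main.v *)
Require Import Defs.
From HB Require Import structures.
From mathcomp Require Import all_boot all_order all_algebra.
From mathcomp Require Import complex.
From mathcomp Require Import all_classical all_reals all_analysis.
From mathcomp Require Import measurable_realfun.
From mathcomp Require Import ring lra.
Import Order.TTheory GRing.Theory Num.Theory.
Import numFieldNormedType.Exports.
Import ComplexField.Normc.

Set Implicit Arguments.
Unset Strict Implicit.
Unset Printing Implicit Defensive.

Local Open Scope classical_set_scope.
Local Open Scope ring_scope.
Local Open Scope complex_scope.

(** The rate [M], the minimum in the exponent, is defined so that
    [M `^ (2 * alpha + 1)] times the spectral norm and [M `^ (alpha + 1 / 2)] times
    the Frobenius norm are at most [t], and the growth hypothesis makes [M] larger
    than any multiple of [ln n] when [n] is large. Hence a bound that loses powers of [n] in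
    front of [expR (- c * M)] is good enough, and the proof can truncate.

    Truncate all coordinates at [K = M `^ alpha]. By the sub-exponential
    hypothesis this fails with probability at most [n * a * expR (- b * M)], and it
    changes means and variances by exponentially small quantities
    ([tail_second_moment]). Round also the truncated variables to a fine grid:
    by independence their joint law is then a product law on a finite set
    ([cells_independent], [finite_event_le]), where expectations are finite
    sums and conditioning on all coordinates but one is elementary.

    There remains a Hanson-Wright inequality for independent centered variables
    bounded by a multiple of [K] and of variance about one, with deviation exponent
    the minimum of [t ^+ 2 / (K ^+ 2 * F ^+ 2)] and [t / (K ^+ 2 * S)], where [F] and [S]
    are the Frobenius and spectral norms. The variance must be used, since
    boundedness alone would give [K ^+ 4] in the first term. The off-diagonal
    part is decoupled by a random subset [J] of the indices ([decoupling]).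
    Integrating out the coordinates in [J] leaves the exponential of a multiple of
    the square norm of [A] applied to the other coordinates ([decoupled_mgf]). The
    moment generating function of this square norm is bounded by decoupling it
    in turn, which reproduces expectations of the same kind to a smaller power, so
    that the largest of them satisfies a closed inequality ([partial_image_mgf]).
    The diagonal part is a sum of independent variables ([diag_mgf]), and the
    exponential Markov inequality with parameter proportional to [M / t] concludes
    ([quadratic_form_tail]). *)

(** * Elementary real inequalities *)

Section RealBounds.
Variable R : realType.
Implicit Types x y : R.

Lemma expR_le_quadratic x : x <= 1 / 2 -> expR x <= 1 + x + 2 * x ^+ 2.
Proof.
move=> x12; have h : 1 - x <= expR (- x) by exact: expR_ge1Dx.
have x1 : 0 < 1 - x by lra.
rewrite -[x in expR x]opprK expRN.
apply: (@le_trans _ _ (1 - x)^-1); first by rewrite lef_pV2 ?posrE ?expR_gt0.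
rewrite -[X in X <= _]mul1r ler_pdivrMr //.
have : 0 <= x ^+ 2 * (1 - 2 * x) by rewrite mulr_ge0 ?sqr_ge0//; lra.
by rewrite !expr2; nra.
Qed.

(** Applied to a centered variable, the linear term averages to zero and only
    a sub-Gaussian factor is left: this one inequality plays the role of
    the lemma of Hoeffding. *)
Lemma expR_le_id_square x : expR x <= x + expR (2 * x ^+ 2).
Proof.
have [x12|x12] := leP x (1 / 2).
  apply: le_trans (expR_le_quadratic x12) _.
  by have := expR_ge1Dx (2 * x ^+ 2); lra.
have : expR x <= expR (2 * x ^+ 2) by rewrite ler_expR expr2; nra.
by lra.
Qed.

(** The common core of the two Cauchy-Schwarz inequalities below. The degenerate
    case [b = 0] asks for its own choice of coefficients. *)
Lemma discriminant_le (a b c : R) : 0 <= a ->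
  (forall x y : R, 0 <= x ^+ 2 * a + (2 * x * y) * c + y ^+ 2 * b) ->
  0 <= b -> c ^+ 2 <= a * b.
Proof.
move=> a0 quad b0; have [b1|b1] := ltP 0 b.
  have := quad b (- c).
  have -> : b ^+ 2 * a + 2 * b * - c * c + (- c) ^+ 2 * b = b * (a * b - c ^+ 2) by ring.
  by rewrite pmulr_rge0 // subr_ge0.
have b00 : b = 0 by apply/eqP; rewrite eq_le b1 b0.
have := quad c (- (a + 1)); rewrite b00 mulr0 addr0 mulr0.
have -> : c ^+ 2 * a + 2 * c * - (a + 1) * c = - (c ^+ 2 * (a + 2)) by ring.
by rewrite oppr_ge0 pmulr_lle0 //; lra.
Qed.

Lemma le_of_eq x y : x = y -> x <= y.
Proof. by move=> ->. Qed.

End RealBounds.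

(** * Expectation on a finite product space *)

Section FiniteProduct.
Variables (R : realType) (I V : finType) (p : I -> V -> R).
Hypothesis p_ge0 : forall i v, 0 <= p i v.
Hypothesis p_sum1 : forall i, \sum_v p i v = 1.

Notation conf := {ffun I -> V}.

Definition fweight (f : conf) : R := \prod_i p i (f i).

Definition fexp (g : conf -> R) : R := \sum_f fweight f * g f.

Definition update (f : conf) i v : conf := [ffun k => if k == i then v else f k].

Lemma updateE f i v k : update f i v k = if k == i then v else f k.
Proof. by rewrite ffunE. Qed.

(** Measurability with respect to the other coordinates, stated as invariance
    under changing coordinate [i]. *)
Definition free_of (U : Type) i (g : conf -> U) := forall f v, g (update f i v) = g f.

Lemma fweight_ge0 f : 0 <= fweight f.
Proof. by apply: prodr_ge0. Qed.

Lemma fexp_prod (h : I -> V -> R) :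
  fexp (fun f => \prod_i h i (f i)) = \prod_i \sum_v p i v * h i v.
Proof.
by rewrite bigA_distr_bigA /fexp; apply: eq_bigr => f _; rewrite -big_split.
Qed.

Lemma fexp_cst c : fexp (fun=> c) = c.
Proof.
rewrite /fexp -mulr_suml -[RHS]mul1r; congr (_ * _).
by rewrite -(bigA_distr_bigA p) big1.
Qed.

Lemma eq_fexp g h : g =1 h -> fexp g = fexp h.
Proof. by move=> gh; apply: eq_bigr => f _; rewrite gh. Qed.

Lemma ler_fexp g h : (forall f, g f <= h f) -> fexp g <= fexp h.
Proof. by move=> gh; apply: ler_sum => f _; rewrite ler_wpM2l ?fweight_ge0. Qed.

Lemma fexp_ge0 g : (forall f, 0 <= g f) -> 0 <= fexp g.
Proof. by move=> g0; apply: sumr_ge0 => f _; rewrite mulr_ge0 ?fweight_ge0. Qed.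

Lemma fexpD g h : fexp (fun f => g f + h f) = fexp g + fexp h.
Proof. by rewrite /fexp -big_split; apply: eq_bigr => f _; rewrite mulrDr. Qed.

Lemma fexpZ c g : fexp (fun f => c * g f) = c * fexp g.
Proof. by rewrite /fexp mulr_sumr; apply: eq_bigr => f _; rewrite mulrCA. Qed.

Lemma fexp_sum (J : finType) (P : pred J) (g : J -> conf -> R) :
  fexp (fun f => \sum_(j | P j) g j f) = \sum_(j | P j) fexp (g j).
Proof.
rewrite exchange_big; apply: eq_bigr => f _.
by rewrite mulr_sumr.
Qed.

(** Resampling one coordinate leaves the law unchanged: exchanging the fresh
    value with the old one is an involution preserving the weight of the pair.
    Conditioning on all other coordinates is done through this identity. *)
Lemma fexp_resample i g :
  fexp g = fexp (fun f => \sum_v p i v * g (update f i v)).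
Proof.
pose s (x : conf * V) : conf * V := (update x.1 i x.2, x.1 i).
have sK : involutive s.
  move=> [f v]; rewrite /s /=; congr pair; last by rewrite ffunE eqxx.
  by apply/ffunP => k; rewrite !ffunE; case: eqP => [->|//].
have wE (x : conf * V) :
    fweight (s x).1 * p i (s x).2 = fweight x.1 * p i x.2.
  case: x => f v; rewrite /s /= /fweight (bigD1 i)//= [in RHS](bigD1 i)//=.
  rewrite ffunE eqxx.
  have -> : \prod_(k | k != i) p k (update f i v k) = \prod_(k | k != i) p k (f k).
    by apply: eq_bigr => k /negbTE ki; rewrite ffunE ki.
  by ring.
transitivity (\sum_(x : conf * V) fweight x.1 * p i x.2 * g x.1).
  rewrite -(pair_big xpredT xpredT (fun f v => fweight f * p i v * g f)) /=.
  apply: eq_bigr => f _; rewrite -mulr_suml -mulr_sumr p_sum1 mulr1 //.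
rewrite (reindex_inj (inv_inj sK)).
rewrite /fexp (eq_bigr (fun x : conf * V => fweight x.1 * p i x.2 * g (update x.1 i x.2))); last first.
  by move=> x _; rewrite wE.
rewrite -(pair_big xpredT xpredT (fun f v => fweight f * p i v * g (update f i v))) /=.
apply: eq_bigr => f _; rewrite mulr_sumr.
by apply: eq_bigr => v _; rewrite mulrA.
Qed.

Lemma fexp_cauchy_schwarz g h :
  fexp (fun f => g f * h f) ^+ 2
    <= fexp (fun f => g f ^+ 2) * fexp (fun f => h f ^+ 2).
Proof.
apply: discriminant_le => [|x y|]; try by apply: fexp_ge0 => f; exact: sqr_ge0.
rewrite -!fexpZ -!fexpD; apply: fexp_ge0 => f.
have -> : x ^+ 2 * g f ^+ 2 + 2 * x * y * (g f * h f) + y ^+ 2 * h f ^+ 2 =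
          (x * g f + y * h f) ^+ 2 by ring.
exact: sqr_ge0.
Qed.

(** Averages the tangent line of the exponential at the mean. *)
Lemma fexp_jensen_expR g : expR (fexp g) <= fexp (fun f => expR (g f)).
Proof.
set m := fexp g.
have -> : expR m = fexp (fun f => expR m * (1 - m) + expR m * g f).
  by rewrite fexpD fexp_cst fexpZ -/m; ring.
apply: ler_fexp => f.
have := expR_ge1Dx (g f - m); rewrite expRD expRN.
move=> /(ler_wpM2l (expR_ge0 m)).
rewrite [X in _ <= X -> _]mulrCA divff ?gt_eqF ?expR_gt0// mulr1 => h.
by apply: le_trans h; rewrite -mulrDr ler_wpM2l ?expR_ge0//; lra.
Qed.

Lemma fexp_markov (g : conf -> R) (t : R) (E : pred conf) :
  (forall f, E f -> t <= g f) ->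
  fexp (fun f => (E f)%:R) <= expR (- t) * fexp (fun f => expR (g f)).
Proof.
move=> tg; rewrite -fexpZ; apply: ler_fexp => f.
rewrite -expRD; case: (boolP (E f)) => [/tg h|_]; last exact: expR_ge0.
by rewrite -[true%:R]expR0 ler_expR; lra.
Qed.

End FiniteProduct.

(** * The complex plane as a real inner product space *)

Section ComplexPlane.
Variable R : realType.
Implicit Types x y z : R[i].

Definition nsq z : R := complex.Re z ^+ 2 + complex.Im z ^+ 2.

Definition dot x y : R := complex.Re x * complex.Re y + complex.Im x * complex.Im y.

Lemma nsq_ge0 z : 0 <= nsq z.
Proof. by rewrite addr_ge0 ?sqr_ge0. Qed.

Lemma normc_sqr z : normc z ^+ 2 = nsq z.
Proof. by case: z => a b; rewrite /nsq /= sqr_sqrtr ?addr_ge0 ?sqr_ge0. Qed.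

Lemma normc_nneg z : 0 <= normc z.
Proof. by case: z => a b; exact: sqrtr_ge0. Qed.

Lemma nsq0 : nsq 0 = 0.
Proof. by rewrite /nsq /= expr0n addr0. Qed.

Lemma nsqM x y : nsq (x * y) = nsq x * nsq y.
Proof. by case: x => a b; case: y => c d; rewrite /nsq /=; ring. Qed.

Lemma dot0 x : dot x 0 = 0.
Proof. by rewrite /dot /= !mulr0 addr0. Qed.

Lemma dotD x y z : dot x (y + z) = dot x y + dot x z.
Proof. by case: x => a b; case: y => c d; case: z => e f; rewrite /dot /=; ring. Qed.

Lemma dotC x y : dot x y = dot y x.
Proof. by rewrite /dot; ring. Qed.

Lemma dot_sumr (J : Type) (r : seq J) (P : pred J) x (F : J -> R[i]) :
  dot x (\sum_(j <- r | P j) F j) = \sum_(j <- r | P j) dot x (F j).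
Proof. by apply: (big_morph (dot x) (dotD x)); exact: dot0. Qed.

Lemma dot_suml (J : Type) (r : seq J) (P : pred J) x (F : J -> R[i]) :
  dot (\sum_(j <- r | P j) F j) x = \sum_(j <- r | P j) dot (F j) x.
Proof. by rewrite dotC dot_sumr; apply: eq_bigr => j _; rewrite dotC. Qed.

Lemma dotxx x : dot x x = nsq x.
Proof. by rewrite /dot /nsq; ring. Qed.

Lemma dot_adjoint a x y : dot (a * x) y = dot x (conjc a * y).
Proof. by case: a => a a'; case: x => c d; case: y => e f; rewrite /dot /=; ring. Qed.

Lemma dot_conj x y : dot x y = complex.Re (conjc x * y).
Proof. by case: x => a b; case: y => c d; rewrite /dot /=; ring. Qed.

Lemma dotZr (c : R) x y : dot x (c%:C * y) = c * dot x y.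
Proof. by case: x => a b; case: y => e f; rewrite /dot /=; ring. Qed.

Lemma nsqZ (c : R) x : nsq (c%:C * x) = c ^+ 2 * nsq x.
Proof. by case: x => a b; rewrite /nsq /=; ring. Qed.

(** The defect is the square of the imaginary part of [conjc x * y]. *)
Lemma dot_sqr_le x y : dot x y ^+ 2 <= nsq x * nsq y.
Proof.
have -> : nsq x * nsq y = dot x y ^+ 2
    + (complex.Re x * complex.Im y - complex.Im x * complex.Re y) ^+ 2.
  by rewrite /nsq /dot; ring.
by rewrite lerDl sqr_ge0.
Qed.

End ComplexPlane.

(** * Operator bounds *)

Section OperatorNorm.
Variables (R : realType) (I : finType).
Implicit Types (A : I -> I -> R[i]) (u : I -> R[i]) (s : R).

Definition l2sq u : R := \sum_i nsq (u i).

Lemma l2sq_ge0 u : 0 <= l2sq u.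
Proof. by apply: sumr_ge0 => i _; exact: nsq_ge0. Qed.

Definition apply_mx A u : I -> R[i] := fun i => \sum_j A i j * u j.

Definition adjoint_mx A : I -> I -> R[i] := fun i j => conjc (A j i).

(** [s] bounds the square of the operator norm; squares avoid all square roots
    in the moment generating function estimates. *)
Definition op_bound A s := forall u, l2sq (apply_mx A u) <= s * l2sq u.

Lemma dot_cauchy_schwarz (u v : I -> R[i]) :
  (\sum_i dot (u i) (v i)) ^+ 2 <= l2sq u * l2sq v.
Proof.
apply: discriminant_le => [|x y|]; try exact: l2sq_ge0.
rewrite /l2sq !mulr_sumr -!big_split /=; apply: sumr_ge0 => i _.
have -> : x ^+ 2 * nsq (u i) + 2 * x * y * dot (u i) (v i) + y ^+ 2 * nsq (v i)
   = (x * complex.Re (u i) + y * complex.Re (v i)) ^+ 2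
     + (x * complex.Im (u i) + y * complex.Im (v i)) ^+ 2.
  by rewrite /nsq /dot; ring.
by rewrite addr_ge0 ?sqr_ge0.
Qed.

(** With [z = A^* u], the square norm of [z] is the inner product of [u] and
    [A z], so Cauchy-Schwarz bounds its square by itself times the claimed bound. *)
Lemma op_bound_adjoint A s : 0 <= s -> op_bound A s -> op_bound (adjoint_mx A) s.
Proof.
move=> s0 As u; set z := apply_mx (adjoint_mx A) u.
have zE : l2sq z = \sum_i dot (u i) (apply_mx A z i).
  rewrite /l2sq (eq_bigr (fun j => \sum_i dot (u i) (A i j * z j))); last first.
    move=> j _; rewrite -dotxx {1}/z /apply_mx dot_suml; apply: eq_bigr => i _.
    by rewrite /adjoint_mx dot_adjoint conjcK.
  by rewrite exchange_big; apply: eq_bigr => i _; rewrite -dot_sumr.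
have h : l2sq z ^+ 2 <= l2sq u * (s * l2sq z).
  rewrite {1}zE; apply: le_trans (dot_cauchy_schwarz _ _) _.
  by rewrite ler_wpM2l ?l2sq_ge0.
have [z0|z0] := ltP 0 (l2sq z); last first.
  by apply: le_trans z0 _; rewrite mulr_ge0 ?l2sq_ge0.
by rewrite -(ler_pM2r z0) -expr2; apply: le_trans h _; rewrite mulrCA mulrA.
Qed.

Lemma op_bound_col A s j : op_bound A s -> \sum_i nsq (A i j) <= s.
Proof.
move=> /(_ (fun k => (k == j)%:R)); rewrite /l2sq /apply_mx.
rewrite (eq_bigr (fun i => nsq (A i j))); last first.
  move=> i _; rewrite (bigD1 j)//= eqxx mulr1 big1 ?addr0// => k /negbTE ->.
  by rewrite mulr0.
have -> : \sum_k nsq ((k == j)%:R : R[i]) = 1 :> R.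
  rewrite (bigD1 j)//= eqxx big1 ?addr0; last by move=> k /negbTE ->; rewrite nsq0.
  by rewrite /nsq /= expr1n expr0n addr0.
by rewrite mulr1.
Qed.

Lemma op_bound_entry A s i j : op_bound A s -> nsq (A i j) <= s.
Proof.
move=> /(op_bound_col j); apply: le_trans.
by rewrite (bigD1 i)//= lerDl; apply: sumr_ge0 => k _; exact: nsq_ge0.
Qed.

End OperatorNorm.

(** * Linear forms with independent random coefficients *)

Section Chaos.
Variables (R : realType) (I V : finType) (p : I -> V -> R).
Hypothesis p_ge0 : forall i v, 0 <= p i v.
Hypothesis p_sum1 : forall i, \sum_v p i v = 1.
Notation conf := {ffun I -> V}.
Variables (z : I -> V -> R[i]) (k : R).
Hypothesis z_mean0 : forall i x, \sum_v p i v * dot (z i v) x = 0.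
Hypothesis z_bound : forall i v, nsq (z i v) <= k.

Let E := fexp p.

Lemma fexp_dot_eq0 i (w : conf -> R[i]) (h : conf -> R) :
  free_of i w -> free_of i h -> E (fun f => dot (z i (f i)) (w f) * h f) = 0.
Proof.
move=> wi hi; rewrite /E (fexp_resample p_sum1 i) -[RHS](fexp_cst p_sum1 0).
apply: eq_fexp => f.
rewrite (eq_bigr (fun v => p i v * dot (z i v) (w f) * h f)).
  by rewrite -mulr_suml z_mean0 mul0r.
by move=> v _; rewrite wi hi ffunE eqxx mulrA.
Qed.

(** Integrates out one coordinate: the linear term of [expR_le_id_square]
    vanishes since the mean is zero, and the quadratic one is bounded using
    the pointwise bound [k] on the squared modulus. *)
Lemma fexp_linear_step i (w : conf -> R[i]) (h : conf -> R) :
  (forall f, 0 <= h f) -> free_of i w -> free_of i h ->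
  E (fun f => expR (dot (z i (f i)) (w f)) * h f)
    <= E (fun f => expR (2 * k * nsq (w f)) * h f).
Proof.
move=> h0 wi hi.
apply: (@le_trans _ _ (E (fun f => dot (z i (f i)) (w f) * h f
                           + expR (2 * k * nsq (w f)) * h f))).
  apply: ler_fexp => // f; rewrite -mulrDl ler_wpM2r //.
  apply: le_trans (expR_le_id_square _) _; rewrite lerD2l ler_expR -mulrA ler_pM2l//.
  apply: le_trans (dot_sqr_le _ _) _.
  by rewrite ler_wpM2r ?nsq_ge0.
by rewrite /E fexpD -/E fexp_dot_eq0// add0r.
Qed.

(** The weight [h] carries the coordinates that were already integrated out, and
    those still to come, through the induction. *)
Lemma fexp_linear_seq (s : seq I) (w : I -> conf -> R[i]) (h : conf -> R) :
  uniq s -> (forall f, 0 <= h f) ->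
  {in s, forall i, free_of i h} -> {in s &, forall i j, free_of i (w j)} ->
  E (fun f => expR (\sum_(i <- s) dot (z i (f i)) (w i f)) * h f)
    <= E (fun f => expR (2 * k * \sum_(i <- s) nsq (w i f)) * h f).
Proof.
elim: s h => [|i s IH] h /=.
  move=> _ _ _ _; apply: le_of_eq.
  by apply: eq_fexp => f; rewrite !big_nil mulr0.
move=> /andP[si us] h0 hi wi.
have is0 : i \in i :: s by rewrite inE eqxx.
have js0 j : j \in s -> j \in i :: s by rewrite inE => ->; rewrite orbT.
pose h1 (f : conf) := expR (\sum_(j <- s) dot (z j (f j)) (w j f)) * h f.
pose h2 (f : conf) := expR (2 * k * nsq (w i f)) * h f.
apply: (@le_trans _ _ (E (fun f => expR (dot (z i (f i)) (w i f)) * h1 f))).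
  apply: le_of_eq; apply: eq_fexp => f.
  by rewrite big_cons expRD mulrA.
apply: (@le_trans _ _ (E (fun f => expR (2 * k * nsq (w i f)) * h1 f))).
  apply: fexp_linear_step.
  - by move=> f; rewrite mulr_ge0 ?expR_ge0.
  - exact: wi.
  - move=> f v; rewrite /h1 hi//; congr (expR _ * _).
    apply: eq_big_seq => j js; rewrite (wi _ _ is0 (js0 _ js)) ffunE.
    by case: eqP => // ji; rewrite -ji js in si.
have -> : E (fun f => expR (2 * k * nsq (w i f)) * h1 f) =
          E (fun f => expR (\sum_(j <- s) dot (z j (f j)) (w j f)) * h2 f).
  by apply: eq_fexp => f; rewrite /h1 /h2 mulrCA.
apply: le_trans (IH h2 us _ _ _) _.
- by move=> f; rewrite mulr_ge0 ?expR_ge0.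
- by move=> j js f v; rewrite /h2 (hi _ (js0 _ js)) (wi _ _ (js0 _ js) is0).
- by move=> j l js ls; apply: wi; apply: js0.
apply: le_of_eq; apply: eq_fexp => f.
by rewrite /h2 big_cons [in RHS]mulrDr expRD; ring.
Qed.

Lemma fexp_linear_le (P : pred I) (w : I -> conf -> R[i]) :
  (forall i j, P i -> P j -> free_of i (w j)) ->
  E (fun f => expR (\sum_(i | P i) dot (z i (f i)) (w i f)))
    <= E (fun f => expR (2 * k * \sum_(i | P i) nsq (w i f))).
Proof.
move=> wP; have := @fexp_linear_seq (enum P) w (fun=> 1) (enum_uniq _).
have eqE g : E (fun f => g f * 1) = E g by apply: eq_fexp => f; rewrite mulr1.
rewrite !eqE /E.
have sumE (F : I -> R) : \sum_(i <- enum P) F i = \sum_(i | P i) F i.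
  by rewrite big_enum.
rewrite (@eq_fexp _ _ _ _ _ (fun f => expR (\sum_(i | P i) dot (z i (f i)) (w i f)))); last first.
  by move=> f; rewrite sumE.
rewrite (@eq_fexp _ _ _ _ (fun f => expR (2 * k * \sum_(i <- enum P) nsq (w i f)))
   (fun f => expR (2 * k * \sum_(i | P i) nsq (w i f)))); last first.
  by move=> f; rewrite sumE.
apply=> // i j; rewrite !mem_enum; exact: wP.
Qed.

End Chaos.

(** * Decoupling by a random subset *)

Section Decoupling.
Variables (R : realType) (I : finType).

Definition fair_coin (i : I) (b : bool) : R := 1 / 2.

Lemma fair_coin_ge0 i b : 0 <= fair_coin i b. Proof. by rewrite /fair_coin; lra. Qed.

Lemma fair_coin_sum1 i : \sum_b fair_coin i b = 1.
Proof. by rewrite big_bool /fair_coin /=; lra. Qed.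

Lemma fair_coin_split (i j : I) : i != j ->
  fexp fair_coin (fun J => (J i && ~~ J j)%:R) = 1 / 4.
Proof.
move=> ij; rewrite (fexp_resample fair_coin_sum1 i) (fexp_resample fair_coin_sum1 j).
rewrite -[RHS](fexp_cst fair_coin_sum1 (1 / 4)); apply: eq_fexp => J.
rewrite !big_bool /= /fair_coin !updateE eqxx [j == i]eq_sym (negbTE ij) /= ?eqxx /=.
by lra.
Qed.

(** Put each index on one side or the other by tossing a fair coin. An ordered
    pair of distinct indices is cut the right way with probability [1 / 4], so the
    off-diagonal sum is four times an average of decoupled sums; conclude with the
    convexity of the exponential. *)
Lemma decoupling (c : I -> I -> R) :
  expR (\sum_i \sum_(j | j != i) c i j) <=
  fexp fair_coin (fun J => expR (4 * \sum_(i | J i) \sum_(j | ~~ J j) c i j)).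
Proof.
apply: le_trans (fexp_jensen_expR fair_coin_ge0 fair_coin_sum1 _).
rewrite ler_expR fexpZ.
rewrite (@eq_fexp _ _ _ _ _
   (fun J => \sum_i \sum_j c i j * (J i && ~~ J j)%:R)); last first.
  move=> J; rewrite big_mkcond; apply: eq_bigr => i _.
  rewrite big_mkcond; case: ifP => Ji; last by rewrite big1// => j _; rewrite mulr0.
  by apply: eq_bigr => j _; case: ifP => _; rewrite ?mulr1 ?mulr0.
rewrite fexp_sum mulr_sumr; apply: ler_sum => i _.
rewrite fexp_sum mulr_sumr big_mkcond /=; apply: ler_sum => j _.
rewrite fexpZ; case: ifP => [ji|/negbFE/eqP ->].
  by rewrite fair_coin_split 1?eq_sym//; lra.
rewrite (@eq_fexp _ _ _ _ _ (fun=> 0)) ?(fexp_cst fair_coin_sum1) ?mulr0//.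
by move=> J; rewrite andbN.
Qed.

Lemma fexp_exchange (V : finType) (p : I -> V -> R) (g : {ffun I -> V} -> {ffun I -> bool} -> R) :
  fexp p (fun f => fexp fair_coin (g f)) =
  fexp fair_coin (fun J => fexp p (fun f => g f J)).
Proof.
rewrite /fexp; under eq_bigr do rewrite mulr_sumr.
rewrite exchange_big; apply: eq_bigr => J _; rewrite mulr_sumr.
by apply: eq_bigr => f _; rewrite mulrCA.
Qed.

End Decoupling.

(** * Moment generating function of a quadratic form *)

Section HansonWright.
Variables (R : realType) (I V : finType) (p : I -> V -> R).
Hypothesis p_ge0 : forall i v, 0 <= p i v.
Hypothesis p_sum1 : forall i, \sum_v p i v = 1.
Notation conf := {ffun I -> V}.
Variables (z : I -> V -> R[i]) (k : R).
Hypothesis k_ge0 : 0 <= k.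
Hypothesis z_mean0 : forall i x, \sum_v p i v * dot (z i v) x = 0.
Hypothesis z_bound : forall i v, nsq (z i v) <= k.
Hypothesis z_var : forall i, \sum_v p i v * nsq (z i v) <= 2.

Let E := fexp p.
Let zeta (f : conf) i := z i (f i).

(** After decoupling, the coordinates inside [J] see coefficients that depend
    only on the coordinates outside [J], so they can be integrated out. *)
Lemma decoupled_mgf (B : I -> I -> R[i]) (lam : R) :
  E (fun f => expR (lam * \sum_i \sum_(j | j != i) dot (zeta f i) (B i j * zeta f j)))
  <= fexp (fair_coin R (I := I)) (fun J => E (fun f =>
       expR (32 * k * lam ^+ 2 * \sum_(i | J i) nsq (\sum_(j | ~~ J j) B i j * zeta f j)))).
Proof.
apply: (@le_trans _ _ (E (fun f => fexp (fair_coin R (I := I)) (fun J =>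
    expR (4 * \sum_(i | J i) \sum_(j | ~~ J j) lam * dot (zeta f i) (B i j * zeta f j)))))).
  apply: ler_fexp => // f; apply: le_trans (decoupling _).
  rewrite ler_expR mulr_sumr; apply: ler_sum => i _.
  by rewrite mulr_sumr.
rewrite /E fexp_exchange -/E; apply: ler_fexp => [|J]; first exact: fair_coin_ge0.
pose w i (f : conf) := (4 * lam)%:C * \sum_(j | ~~ J j) B i j * zeta f j.
rewrite /E (@eq_fexp _ _ _ _ _
  (fun f => expR (\sum_(i | J i) dot (z i (f i)) (w i f)))); last first.
  move=> f; congr expR; rewrite mulr_sumr; apply: eq_bigr => i _.
  by rewrite /w dotZr dot_sumr -mulr_sumr mulrA.
apply: le_trans (fexp_linear_le p_ge0 p_sum1 z_mean0 z_bound _) _.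
  move=> i j Ji Jj f v; congr (_ * _); apply: eq_bigr => l Jl.
  congr (_ * _); rewrite /zeta updateE; case: eqP => // li.
  by rewrite li Ji in Jl.
apply: le_of_eq; apply: eq_fexp => f; congr expR.
rewrite mulr_sumr [RHS]mulr_sumr; apply: eq_bigr => i _.
by rewrite /w nsqZ; ring.
Qed.

Variables (A : I -> I -> R[i]) (s : R).
Hypothesis s_ge0 : 0 <= s.
Hypothesis A_bound : op_bound A s.

Let F2 := \sum_i \sum_j nsq (A i j).

Definition partial_image (S : {set I}) (f : conf) (i : I) : R[i] :=
  \sum_(j in S) A i j * zeta f j.

Let gram (i j : I) : R[i] := \sum_l conjc (A l i) * A l j.

Let gramS (S : {set I}) i j : R[i] := if (i \in S) && (j \in S) then gram i j else 0.

(** The diagonal is a sum of independent variables, and the off-diagonal part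
    can be decoupled. *)
Lemma partial_image_expand S f :
  l2sq (partial_image S f) =
    \sum_(i in S) (\sum_l nsq (A l i)) * nsq (zeta f i)
    + \sum_i \sum_(j | j != i) dot (zeta f i) (gramS S i j * zeta f j).
Proof.
have -> : l2sq (partial_image S f) =
    \sum_(i in S) \sum_(j in S) dot (zeta f i) (gram i j * zeta f j).
  rewrite /l2sq (eq_bigr (fun l => \sum_(i in S) \sum_(j in S)
      dot (zeta f i) (conjc (A l i) * A l j * zeta f j))); last first.
    move=> l _; rewrite -dotxx /partial_image dot_suml; apply: eq_bigr => i _.
    rewrite dot_sumr; apply: eq_bigr => j _.
    by rewrite dot_adjoint mulrA.
  rewrite exchange_big; apply: eq_bigr => i _.
  rewrite exchange_big; apply: eq_bigr => j _.
  by rewrite -dot_sumr -mulr_suml.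
rewrite big_mkcond [X in _ = X + _]big_mkcond -big_split /=; apply: eq_bigr => i _.
case: ifPn => iS; last first.
  rewrite add0r big1// => j _.
  by rewrite /gramS (negbTE iS) mul0r dot0.
rewrite (bigD1 i)//=; congr (_ + _).
  rewrite /gram !mulr_suml dot_sumr; apply: eq_bigr => l _.
  by rewrite -mulrA -dot_adjoint dotxx nsqM.
rewrite [RHS]big_mkcond [LHS]big_mkcond; apply: eq_bigr => j _.
by rewrite /gramS iS; case: (j \in S); case: (j != i) => //=; rewrite mul0r dot0.
Qed.

(** The Gram matrix is [A^* A], so the decoupled rows are [A^*] applied to a
    partial image over a smaller index set: the bound stays in the same family of
    random variables, which is what lets [partial_image_mgf] close on itself. *)
Lemma gram_row_le S (J : {ffun I -> bool}) f :
  \sum_(i | J i) nsq (\sum_(j | ~~ J j) gramS S i j * zeta f j)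
    <= s * l2sq (partial_image [set j in S | ~~ J j] f).
Proof.
set u := partial_image _ f.
apply: le_trans (op_bound_adjoint s_ge0 A_bound u).
rewrite big_mkcond /l2sq; apply: ler_sum => i _.
case: ifP => Ji; last exact: nsq_ge0.
have [iS|iS] := boolP (i \in S); last first.
  rewrite big1 ?nsq0 ?nsq_ge0// => j _.
  by rewrite /gramS (negbTE iS) mul0r.
apply: le_of_eq; congr nsq.
rewrite /apply_mx /adjoint_mx /u /partial_image.
under [RHS]eq_bigr do rewrite mulr_sumr.
rewrite [RHS]exchange_big /= [LHS]big_mkcond [RHS]big_mkcond.
apply: eq_bigr => j _; rewrite inE /gramS iS /=.
case: (j \in S) => /=; case: (J j) => //=; last by rewrite mul0r.
by rewrite /gram mulr_suml; apply: eq_bigr => l _; rewrite mulrA.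
Qed.

Lemma col_sum_le : \sum_i \sum_l nsq (A l i) = F2.
Proof. by rewrite exchange_big. Qed.

(** This is where the variance enters: the mean of the diagonal is at most twice
    the squared Frobenius norm, although a single term may be as large as [k * s]. *)
Lemma diag_gram_mgf (S : {set I}) lam : 0 <= lam -> 2 * lam * s * k <= 1 / 2 ->
  E (fun f => expR (2 * lam * \sum_(i in S) (\sum_l nsq (A l i)) * nsq (zeta f i)))
    <= expR (8 * lam * F2).
Proof.
move=> lam0 lamk.
pose h i v : R := if i \in S then expR (2 * lam * (\sum_l nsq (A l i)) * nsq (z i v)) else 1.
rewrite /E (@eq_fexp _ _ _ _ _ (fun f => \prod_i h i (f i))); last first.
  move=> f; rewrite mulr_sumr expR_sum big_mkcond; apply: eq_bigr => i _.
  by rewrite /h; case: ifP => // _; rewrite mulrA.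
rewrite fexp_prod -col_sum_le mulr_sumr expR_sum; apply: ler_prod => i _.
set b := \sum_l nsq (A l i); have b0 : 0 <= b by apply: sumr_ge0 => l _; exact: nsq_ge0.
have bs : b <= s by exact: op_bound_col.
have hi v : 0 <= h i v by rewrite /h; case: ifP => // _; rewrite expR_ge0.
rewrite sumr_ge0 /=; last by move=> v _; rewrite mulr_ge0.
apply: (@le_trans _ _ (1 + 4 * lam * b * 2)); last first.
  by apply: le_trans (expR_ge1Dx _); lra.
apply: (@le_trans _ _ (\sum_v (p i v + 4 * lam * b * (p i v * nsq (z i v))))); last first.
  by rewrite big_split /= p_sum1 -mulr_sumr lerD2l ler_wpM2l ?z_var// !mulr_ge0.
apply: ler_sum => v _.
have -> : p i v + 4 * lam * b * (p i v * nsq (z i v)) =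
   p i v * (1 + 4 * lam * b * nsq (z i v)) by ring.
rewrite ler_wpM2l// /h; have n0 := nsq_ge0 (z i v).
have y0 : 0 <= 2 * lam * b * nsq (z i v) by rewrite !mulr_ge0.
case: ifP => _; last by lra.
have y1 : 2 * lam * b * nsq (z i v) <= 1 / 2.
  apply: le_trans lamk; apply: ler_pM => //; rewrite ?mulr_ge0//.
  by rewrite ler_wpM2l ?mulr_ge0.
by apply: le_trans (expR_le_quadratic y1) _; nra.
Qed.

Lemma ex_max_set (g : {set I} -> R) : exists S, forall S', g S' <= g S.
Proof.
have [S _ SP] := @Order.TotalTheory.arg_maxP _ _ _ (finset.set0 : {set I}) xpredT g isT.
by exists S => S'; exact: SP.
Qed.

(** Self-bounding argument. Let [M] be the largest of these expectations when [S]
    varies. Cauchy-Schwarz separates diagonal and off-diagonal part; decoupling the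
    latter and integrating out the coordinates in [J] gives back expectations of
    the same form, each at most [M] because [lam] is small enough. Thus
    [M ^+ 2 <= expR (8 * lam * F2) * M]. Compared with a direct use of the
    bound [k], the squared Frobenius norm is not multiplied by [k]: this
    replaces the concentration of convex Lipschitz functions. *)
Lemma partial_image_mgf S lam : 0 <= lam -> 128 * k * lam * s <= 1 ->
  E (fun f => expR (lam * l2sq (partial_image S f))) <= expR (8 * lam * F2).
Proof.
move=> lam0 lamk.
pose phi S := E (fun f => expR (lam * l2sq (partial_image S f))).
have [S0 S0max] := ex_max_set phi.
apply: le_trans (S0max S) _; set M := phi S0 in S0max *.
have M1 : 1 <= M.
  rewrite -(fexp_cst p_sum1 1); apply: ler_fexp => // f.
  by rewrite -expR0 ler_expR mulr_ge0// l2sq_ge0.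
have M0 : 0 < M by apply: lt_le_trans M1.
suff : M ^+ 2 <= expR (8 * lam * F2) * M by rewrite expr2 ler_pM2r.
pose d f := \sum_(i in S0) (\sum_l nsq (A l i)) * nsq (zeta f i).
pose o f := \sum_i \sum_(j | j != i) dot (zeta f i) (gramS S0 i j * zeta f j).
have ME : M = E (fun f => expR (lam * d f) * expR (lam * o f)).
  by apply: eq_fexp => f; rewrite partial_image_expand mulrDr expRD.
rewrite {1}ME; apply: le_trans (fexp_cauchy_schwarz p_ge0 _ _) _.
have sqE (g : conf -> R) : fexp p (fun f => expR (lam * g f) ^+ 2)
   = E (fun f => expR (2 * lam * g f)).
  by apply: eq_fexp => f; rewrite expr2 -expRD; congr expR; ring.
rewrite !sqE; apply: ler_pM; try by apply: fexp_ge0 => // f; exact: expR_ge0.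
  apply: diag_gram_mgf => //; nra.
apply: le_trans (decoupled_mgf _ _) _.
rewrite -(fexp_cst (fair_coin_sum1 R (I := I)) M).
apply: ler_fexp => [|J]; first exact: fair_coin_ge0.
apply: le_trans (S0max [set j in S0 | ~~ J j]).
apply: ler_fexp => // f; rewrite ler_expR.
set x := l2sq _; have x0 : 0 <= x by exact: l2sq_ge0.
apply: (@le_trans _ _ (32 * k * (2 * lam) ^+ 2 * (s * x))).
  by rewrite ler_wpM2l ?gram_row_le// mulr_ge0 ?sqr_ge0// mulr_ge0.
have -> : 32 * k * (2 * lam) ^+ 2 * (s * x) = (128 * k * lam * s) * (lam * x) by ring.
by rewrite -[leRHS]mul1r ler_wpM2r// mulr_ge0.
Qed.


(** Decoupling turns the off-diagonal form into the exponential of the square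
    norm of a partial image, whose parameter [32 * k * mu ^+ 2] is admissible for
    [partial_image_mgf] exactly when [(64 * k * mu) ^+ 2 * s <= 1]. *)
Lemma offdiag_mgf mu : (64 * k * mu) ^+ 2 * s <= 1 ->
  E (fun f => expR (mu * \sum_i \sum_(j | j != i) dot (zeta f i) (A i j * zeta f j)))
    <= expR (256 * k * mu ^+ 2 * F2).
Proof.
move=> mus; apply: le_trans (decoupled_mgf _ _) _.
rewrite -(fexp_cst (fair_coin_sum1 R (I := I)) (expR _)).
apply: ler_fexp => [|J]; first exact: fair_coin_ge0.
have -> : 256 * k * mu ^+ 2 * F2 = 8 * (32 * k * mu ^+ 2) * F2 by ring.
have lam0 : 0 <= 32 * k * mu ^+ 2 by rewrite mulr_ge0 ?sqr_ge0// mulr_ge0.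
apply: le_trans (partial_image_mgf [set j | ~~ J j] lam0 _); last first.
  by apply: le_trans mus; apply: le_of_eq; ring.
apply: ler_fexp => // f; rewrite ler_expR ler_wpM2l//.
rewrite /l2sq big_mkcond; apply: ler_sum => i _.
case: ifP => _; last exact: nsq_ge0.
apply: le_of_eq; congr nsq.
by apply: eq_bigl => j; rewrite inE.
Qed.

Definition second_moment i : R := \sum_v p i v * nsq (z i v).

(** A sum of independent centered variables, each of variance at most
    [2 * k * nsq (A i i)]. *)
Lemma diag_mgf mu : (64 * k * mu) ^+ 2 * s <= 1 ->
  E (fun f => expR (mu * \sum_i complex.Re (A i i) * (nsq (zeta f i) - second_moment i)))
    <= expR (4 * k * mu ^+ 2 * F2).
Proof.
move=> mus.
pose h i v : R := expR (mu * (complex.Re (A i i) * (nsq (z i v) - second_moment i))).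
rewrite /E (@eq_fexp _ _ _ _ _ (fun f => \prod_i h i (f i))); last first.
  by move=> f; rewrite mulr_sumr expR_sum.
rewrite fexp_prod.
apply: (@le_trans _ _ (expR (\sum_i 4 * k * mu ^+ 2 * nsq (A i i)))); last first.
  rewrite ler_expR -mulr_sumr ler_wpM2l//; first by rewrite mulr_ge0 ?sqr_ge0// mulr_ge0.
  apply: ler_sum => i _; rewrite (bigD1 i)//= lerDl.
  by apply: sumr_ge0 => j _; exact: nsq_ge0.
rewrite expR_sum; apply: ler_prod => i _.
rewrite sumr_ge0 /=; last by move=> v _; rewrite mulr_ge0 ?expR_ge0.
have [m mE] : {m | second_moment i = m} by exists (second_moment i).
rewrite /h mE; set a := complex.Re (A i i).
have aA : a ^+ 2 <= nsq (A i i) by rewrite /nsq lerDl sqr_ge0.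
have as_ : a ^+ 2 <= s by apply: le_trans aA (op_bound_entry i i A_bound).
have m0 : 0 <= m by rewrite -mE; apply: sumr_ge0 => v _; rewrite mulr_ge0 ?nsq_ge0.
have mk : m <= k.
  rewrite -mE -[leRHS]mul1r -(p_sum1 i) mulr_suml; apply: ler_sum => v _.
  by rewrite ler_wpM2l.
apply: (@le_trans _ _ (1 + 4 * k * mu ^+ 2 * a ^+ 2)); last first.
  apply: le_trans (expR_ge1Dx _) _; rewrite ler_expR ler_wpM2l//.
  by rewrite mulr_ge0 ?sqr_ge0// mulr_ge0.
apply: (@le_trans _ _ (\sum_v p i v * (1 + mu * (a * (nsq (z i v) - m))
     + 2 * (mu * (a * (nsq (z i v) - m))) ^+ 2))).
  apply: ler_sum => v _; rewrite ler_wpM2l//; apply: expR_le_quadratic.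
  have v0 := nsq_ge0 (z i v); have vk := z_bound i v.
  have d2 : (nsq (z i v) - m) ^+ 2 <= k ^+ 2 by rewrite !expr2; nra.
  have : (mu * (a * (nsq (z i v) - m))) ^+ 2 <= (1 / 2) ^+ 2.
    apply: (@le_trans _ _ ((64 * k * mu) ^+ 2 * s / 4)); last by rewrite expr2; lra.
    have -> : (mu * (a * (nsq (z i v) - m))) ^+ 2 =
      mu ^+ 2 * (a ^+ 2 * (nsq (z i v) - m) ^+ 2) by ring.
    have -> : (64 * k * mu) ^+ 2 * s / 4 = mu ^+ 2 * (1024 * (s * k ^+ 2)) by field.
    rewrite ler_wpM2l ?sqr_ge0//.
    have : a ^+ 2 * (nsq (z i v) - m) ^+ 2 <= s * k ^+ 2 by rewrite ler_pM ?sqr_ge0.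
    have : 0 <= s * k ^+ 2 by rewrite mulr_ge0 ?sqr_ge0.
    by lra.
  by move: (mu * _) => y; rewrite !expr2; nra.
have -> : \sum_v p i v * (1 + mu * (a * (nsq (z i v) - m))
     + 2 * (mu * (a * (nsq (z i v) - m))) ^+ 2) =
   1 + 2 * mu ^+ 2 * a ^+ 2 * \sum_v p i v * (nsq (z i v) - m) ^+ 2.
  transitivity ((1 - mu * a * m) * (\sum_v p i v) + mu * a * (\sum_v p i v * nsq (z i v))
      + 2 * mu ^+ 2 * a ^+ 2 * \sum_v p i v * (nsq (z i v) - m) ^+ 2).
    rewrite !mulr_sumr -!big_split /=.
    by apply: eq_bigr => v _; ring.
  by rewrite p_sum1 -/(second_moment i) mE; ring.
rewrite lerD2l.
have vark : \sum_v p i v * (nsq (z i v) - m) ^+ 2 <= 2 * k.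
  apply: (@le_trans _ _ (\sum_v p i v * nsq (z i v) ^+ 2)).
    have -> : \sum_v p i v * nsq (z i v) ^+ 2 =
      \sum_v p i v * (nsq (z i v) - m) ^+ 2 + m ^+ 2.
      transitivity (\sum_v p i v * (nsq (z i v) - m) ^+ 2
        + 2 * m * (\sum_v p i v * nsq (z i v)) - m ^+ 2 * \sum_v p i v).
        rewrite !mulr_sumr -sumrN -!big_split /=.
        by apply: eq_bigr => v _; ring.
      by rewrite p_sum1 -/(second_moment i) mE; ring.
    by rewrite lerDl sqr_ge0.
  apply: (@le_trans _ _ (k * m)); last by rewrite mulrC ler_wpM2r// -mE z_var.
  rewrite -mE mulr_sumr; apply: ler_sum => v _.
  by rewrite [leRHS]mulrCA ler_wpM2l// expr2 ler_wpM2r ?nsq_ge0.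
have c0 : 0 <= 2 * mu ^+ 2 * a ^+ 2 by rewrite mulr_ge0 ?sqr_ge0// mulr_ge0 ?sqr_ge0.
apply: le_trans (ler_wpM2l c0 vark) _.
by apply: le_of_eq; ring.
Qed.

Definition real_chaos (f : conf) : R :=
  (\sum_i \sum_j dot (zeta f i) (A i j * zeta f j))
  - \sum_i complex.Re (A i i) * second_moment i.

Lemma real_chaos_mgf mu : (128 * k * mu) ^+ 2 * s <= 1 ->
  E (fun f => expR (mu * real_chaos f)) <= expR (520 * k * mu ^+ 2 * F2).
Proof.
move=> mus.
pose d f := \sum_i complex.Re (A i i) * (nsq (zeta f i) - second_moment i).
pose o f := \sum_i \sum_(j | j != i) dot (zeta f i) (A i j * zeta f j).
have XE f : real_chaos f = d f + o f.
  rewrite /real_chaos /d /o -sumrB -big_split /=; apply: eq_bigr => i _.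
  rewrite (bigD1 i)//= addrAC; congr (_ + _); rewrite mulrBr; congr (_ - _).
  by rewrite /dot /nsq; case: (A i i) => x y; case: (zeta f i) => x' y' /=; ring.
set M := E _; have M0 : 0 <= M by apply: fexp_ge0 => // f; exact: expR_ge0.
have ME : M = E (fun f => expR (mu * d f) * expR (mu * o f)).
  by apply: eq_fexp => f; rewrite XE mulrDr expRD.
have sqE (g : conf -> R) : fexp p (fun f => expR (mu * g f) ^+ 2)
   = E (fun f => expR (2 * mu * g f)).
  by apply: eq_fexp => f; rewrite expr2 -expRD; congr expR; ring.
have mus' : (64 * k * (2 * mu)) ^+ 2 * s <= 1.
  by apply: le_trans mus; apply: le_of_eq; ring.
rewrite -(ler_pXn2r (n := 2))// ?nnegrE ?expR_ge0// ME.
apply: le_trans (fexp_cauchy_schwarz p_ge0 _ _) _; rewrite !sqE.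
have -> : expR (520 * k * mu ^+ 2 * F2) ^+ 2 =
  expR (4 * k * (2 * mu) ^+ 2 * F2) * expR (256 * k * (2 * mu) ^+ 2 * F2).
  by rewrite expr2 -!expRD; congr expR; ring.
apply: ler_pM; try by apply: fexp_ge0 => // f; exact: expR_ge0.
  exact: diag_mgf.
exact: offdiag_mgf.
Qed.

Lemma real_chaos_tail mu t : 0 <= mu -> (128 * k * mu) ^+ 2 * s <= 1 ->
  E (fun f => (t <= real_chaos f)%R%:R)
    <= expR (- (mu * t) + 520 * k * mu ^+ 2 * F2).
Proof.
move=> mu0 mus; rewrite expRD.
apply: le_trans (ler_wpM2l (expR_ge0 _) (real_chaos_mgf mus)).
by apply: (@fexp_markov _ _ _ _ p_ge0 (fun f => mu * real_chaos f)) => f tf; rewrite ler_wpM2l.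
Qed.

End HansonWright.

(** * Tail of the complex quadratic form *)

Section ComplexTail.
Variables (R : realType) (I V : finType) (p : I -> V -> R).
Hypothesis p_ge0 : forall i v, 0 <= p i v.
Hypothesis p_sum1 : forall i, \sum_v p i v = 1.
Notation conf := {ffun I -> V}.
Variables (z : I -> V -> R[i]) (k : R).
Hypothesis k_ge0 : 0 <= k.
Hypothesis z_mean0 : forall i x, \sum_v p i v * dot (z i v) x = 0.
Hypothesis z_bound : forall i v, nsq (z i v) <= k.
Hypothesis z_var : forall i, \sum_v p i v * nsq (z i v) <= 2.
Variables (A : I -> I -> R[i]) (s : R).
Hypothesis s_ge0 : 0 <= s.
Hypothesis A_bound : op_bound A s.

Definition centered_chaos (f : conf) : R[i] :=
  \sum_i \sum_j conjc (z i (f i)) * (A i j * z j (f j))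
  - \sum_i A i i * (second_moment p z i)%:C.

Lemma op_bound_unimodular u : nsq u = 1 -> op_bound (fun i j => u * A i j) s.
Proof.
move=> u1 x; apply: le_trans (A_bound x).
apply: le_of_eq; apply: eq_bigr => i _.
rewrite /apply_mx; under eq_bigr do rewrite -mulrA.
by rewrite -mulr_sumr nsqM u1 mul1r.
Qed.

Lemma Re_sum (J : Type) (r : seq J) (P : pred J) (F : J -> R[i]) :
  complex.Re (\sum_(j <- r | P j) F j) = \sum_(j <- r | P j) complex.Re (F j).
Proof. by apply: (big_morph (@complex.Re R)) => // -[? ?] [? ?]. Qed.

Lemma real_chaosE u f :
  real_chaos p z (fun i j => u * A i j) f = complex.Re (u * centered_chaos f).
Proof.
rewrite /real_chaos /centered_chaos.
have ReB (x y : R[i]) : complex.Re (u * (x - y)) = complex.Re (u * x) - complex.Re (u * y).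
  by case: u => ? ?; case: x => ? ?; case: y => ? ? /=; ring.
rewrite ReB !mulr_sumr !Re_sum; congr (_ - _); apply: eq_bigr => i _.
  rewrite mulr_sumr Re_sum; apply: eq_bigr => j _.
  by rewrite dot_conj; congr complex.Re; ring.
by clear ReB; case: u => ? ?; case: (A i i) => ? ? /=; ring.
Qed.

Lemma normc_ge_cases (t : R) (w : R[i]) : 0 <= t -> t <= normc w ->
  [|| t / 2 <= complex.Re (1 * w), t / 2 <= complex.Re (-1 * w),
      t / 2 <= complex.Re ('i * w) | t / 2 <= complex.Re (- 'i * w)].
Proof.
move=> t0 tw; have : t ^+ 2 <= nsq w.
  by rewrite -normc_sqr ler_pXn2r// nnegrE normc_nneg.
case: w {tw} => x y; rewrite /nsq /= => h.
have -> : 1 * x - 0 * y = x by ring.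
have -> : -1 * x - -0 * y = - x by ring.
have -> : 0 * x - 1 * y = - y by ring.
have -> : -0 * x - -1 * y = y by ring.
have [//|h1] := boolP (t / 2 <= x); have [//|h2] := boolP (t / 2 <= - x).
have [//|h3] := boolP (t / 2 <= - y); have [//|h4] := boolP (t / 2 <= y).
move: h1 h2 h3 h4; rewrite -!ltNge => h1 h2 h3 h4.
exfalso.
have hx : 0 < (t / 2 - x) * (t / 2 + x) by apply: mulr_gt0; lra.
have hy : 0 < (t / 2 - y) * (t / 2 + y) by apply: mulr_gt0; lra.
have ht : 0 <= t ^+ 2 by exact: sqr_ge0.
by lra.
Qed.

(** A complex number of modulus [t] has real part at least [t / 2] after
    multiplication by one of the four units [1], [-1], [i], [-i], and rotating the
    form is rotating the matrix, which changes neither of its norms. *)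
Lemma centered_chaos_tail mu t : 0 <= mu -> 0 <= t -> (128 * k * mu) ^+ 2 * s <= 1 ->
  fexp p (fun f => (t <= normc (centered_chaos f))%R%:R)
    <= 4 * expR (- (mu * (t / 2)) + 520 * k * mu ^+ 2 * \sum_i \sum_j nsq (A i j)).
Proof.
move=> mu0 t0 mus; set B := expR _.
have dir u : nsq u = 1 ->
    fexp p (fun f => (t / 2 <= complex.Re (u * centered_chaos f))%R%:R) <= B.
  move=> u1.
  have := @real_chaos_tail _ _ _ _ p_ge0 p_sum1 _ _ k_ge0 z_mean0 z_bound z_var _ _
    s_ge0 (op_bound_unimodular u1) mu (t / 2) mu0 mus.
  rewrite (@eq_fexp _ _ _ _ _
    (fun f => (t / 2 <= complex.Re (u * centered_chaos f))%R%:R)); last first.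
    by move=> f; rewrite real_chaosE.
  move=> /le_trans; apply; rewrite ler_expR lerD2l.
  have -> : \sum_i \sum_j nsq (u * A i j) = \sum_i \sum_j nsq (A i j).
    by apply: eq_bigr => i _; apply: eq_bigr => j _; rewrite nsqM u1 mul1r.
  by [].
have h1 := dir 1; have h2 := dir (-1); have h3 := dir 'i; have h4 := dir (- 'i).
apply: (@le_trans _ _ (fexp p (fun f =>
   (t / 2 <= complex.Re (1 * centered_chaos f))%R%:R +
   ((t / 2 <= complex.Re (-1 * centered_chaos f))%R%:R +
   ((t / 2 <= complex.Re ('i * centered_chaos f))%R%:R +
   (t / 2 <= complex.Re (- 'i * centered_chaos f))%R%:R))))).
  apply: ler_fexp => // f.
  case: (boolP (t <= normc (centered_chaos f))) => [/(normc_ge_cases t0)|_]; last by rewrite !addr_ge0.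
  move=> h; rewrite -!natrD ler_nat.
  by move: h; do 4![case: (_ <= complex.Re _)].
rewrite !fexpD.
have := h1 _; have := h2 _; have := h3 _; have := h4 _.
rewrite /nsq /= !(oppr0, sqrrN, expr1n, expr0n) /= !(addr0, add0r) => H4 H3 H2 H1.
by have := H1 erefl; have := H2 erefl; have := H3 erefl; have := H4 erefl; lra.
Qed.

End ComplexTail.

(** * Random variables with finitely many values *)

Section FiniteLaw.
Context d (T : measurableType d) (R : realType) (P : probability T R).
Variable V : finType.

Definition law (N : T -> V) (v : V) : R := fine (P (N @^-1` [set v])).

Lemma law_ge0 N v : 0 <= law N v.
Proof. by rewrite /law fine_ge0. Qed.

Section OneVariable.
Variable N : T -> V.
Hypothesis mN : forall v, measurable (N @^-1` [set v]).

Let stepE (g : V -> R) w :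
  ((g (N w))%:E = \sum_v (g v)%:E * (\1_(N @^-1` [set v]) w)%:E)%E.
Proof.
rewrite (bigD1 (N w))//= indicE mem_set// mule1 big1 ?adde0// => v vN.
rewrite indicE memNset ?mule0// => /= Nv.
by move: vN; rewrite Nv eqxx.
Qed.

Let step_integrable (g : V -> R) v :
  P.-integrable setT (fun w => (g v)%:E * (\1_(N @^-1` [set v]) w)%:E)%E.
Proof. by apply: integrableZl => //; exact: integrable_indic. Qed.

Lemma integrable_law (g : V -> R) : P.-integrable setT (fun w => (g (N w))%:E).
Proof.
rewrite (_ : (fun w => _) =
    fun w => (\sum_v (g v)%:E * (\1_(N @^-1` [set v]) w)%:E)%E); last first.
  by apply/funext => w; exact: stepE.
by apply: integrable_sum.
Qed.

Lemma Rintegral_law (g : V -> R) : \int[P]_w g (N w) = \sum_v law N v * g v.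
Proof.
rewrite /Rintegral (_ : (fun w => _) =
    fun w => (\sum_v (g v)%:E * (\1_(N @^-1` [set v]) w)%:E)%E); last first.
  by apply/funext => w; exact: stepE.
rewrite integral_sum//.
have intE v : (\int[P]_w ((g v)%:E * (\1_(N @^-1` [set v]) w)%:E) = (law N v * g v)%:E)%E.
  rewrite integralZl//; last exact: integrable_indic.
  rewrite integral_indic// setIT EFinM muleC /law fineK//.
  exact: fin_num_measure.
by under eq_bigr do rewrite intE; rewrite sumEFin.
Qed.

Lemma law_sum1 : \sum_v law N v = 1.
Proof.
rewrite (eq_bigr (fun v => law N v * (fun=> 1) v)); last by move=> v _; rewrite mulr1.
rewrite -Rintegral_law Rintegral_cst//.
by rewrite mul1r [X in fine X](probability_setT P).
Qed.

End OneVariable.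

Lemma measure_bigsetU_le (J : Type) (s : seq J) (Q : pred J) (F : J -> set T) :
  (forall j, measurable (F j)) ->
  (P (\big[setU/set0]_(j <- s | Q j) F j) <= \sum_(j <- s | Q j) P (F j))%E.
Proof.
move=> mF; elim: s => [|j s IH]; first by rewrite !big_nil measure0.
rewrite !big_cons; case: ifP => // _.
apply: le_trans (measureU2 _ _ _) _ => //.
  by apply: bigsetU_measurable.
by rewrite leeD2l.
Qed.

Variables (I : finType) (N : I -> T -> V).
Hypothesis mN : forall i v, measurable (N i @^-1` [set v]).
Hypothesis indepN : forall f : {ffun I -> V},
  P [set w | forall i, N i w = f i] = (\prod_i law (N i) (f i))%:E.

Let mcyl (f : {ffun I -> V}) : measurable [set w | forall i, N i w = f i].
Proof.
rewrite (_ : [set _ | _] = \big[setI/setT]_i (N i @^-1` [set f i])).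
  by apply: bigsetI_measurable => i _; exact: mN.
rewrite -bigcap_seq; apply/seteqP; split=> w /=.
  by move=> h i _; exact: h.
by move=> h i; apply: h; rewrite /= mem_index_enum.
Qed.

Let eventE (E : pred {ffun I -> V}) :
  [set w | E [ffun i => N i w]] =
  \big[setU/set0]_(f <- index_enum {ffun I -> V} | E f) [set w | forall i, N i w = f i].
Proof.
rewrite -bigcup_seq_cond; apply/seteqP; split=> w /=.
  by move=> Ew; exists [ffun i => N i w] => /=; rewrite ?mem_index_enum ?Ew// => i; rewrite ffunE.
case=> f /= /andP[_ Ef] Nf.
by rewrite (_ : [ffun i => N i w] = f)//; apply/ffunP => i; rewrite ffunE Nf.
Qed.

Lemma measurable_finite_event (E : pred {ffun I -> V}) :
  measurable [set w | E [ffun i => N i w]].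
Proof. by rewrite eventE; apply: bigsetU_measurable. Qed.

(** A union bound over the configurations in [E]: from here on, only finite sums
    are involved. *)
Lemma finite_event_le (E : pred {ffun I -> V}) :
  (P [set w | E [ffun i => N i w]] <=
    (fexp (fun i => law (N i)) (fun f => (E f)%:R))%:E)%E.
Proof.
rewrite eventE; apply: le_trans (measure_bigsetU_le _ _ mcyl) _.
rewrite /fexp -sumEFin big_mkcond; apply: lee_sum => f _.
by case: ifP => Ef; rewrite ?mulr1 ?mulr0// indepN.
Qed.

End FiniteLaw.

(** * Measurability of complex valued functions *)

Section MeasurableComplex.
Context d (T : measurableType d) (R : realType).
Implicit Types Y : T -> R[i].

Definition measurable_parts Y :=
  measurable_fun setT (fun w => complex.Re (Y w)) /\
  measurable_fun setT (fun w => complex.Im (Y w)).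

Lemma complex_rvP Y : complex_rv Y -> measurable_parts Y.
Proof.
move=> mY; split; first exact: (measurableT_comp (@measurable_fst _ _ _ _) mY).
exact: (measurableT_comp (@measurable_snd _ _ _ _) mY).
Qed.

Lemma measurable_parts_cst (c : R[i]) : measurable_parts (fun=> c).
Proof. by split; exact: measurable_cst. Qed.

Lemma measurable_partsD Y Z : measurable_parts Y -> measurable_parts Z ->
  measurable_parts (fun w => Y w + Z w).
Proof.
move=> [Y1 Y2] [Z1 Z2]; split.
- rewrite (_ : (fun w => _) = (fun w => complex.Re (Y w) + complex.Re (Z w))).
    exact: measurable_funD.
  by apply/funext => w; case: (Y w) => ? ?; case: (Z w).
- rewrite (_ : (fun w => _) = (fun w => complex.Im (Y w) + complex.Im (Z w))).
    exact: measurable_funD.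
  by apply/funext => w; case: (Y w) => ? ?; case: (Z w).
Qed.

Lemma measurable_partsM Y Z : measurable_parts Y -> measurable_parts Z ->
  measurable_parts (fun w => Y w * Z w).
Proof.
move=> [Y1 Y2] [Z1 Z2]; split.
- rewrite (_ : (fun w => _) = (fun w => complex.Re (Y w) * complex.Re (Z w)
      - complex.Im (Y w) * complex.Im (Z w))).
    by apply: measurable_funB; exact: measurable_funM.
  by apply/funext => w; case: (Y w) => ? ?; case: (Z w).
- rewrite (_ : (fun w => _) = (fun w => complex.Re (Y w) * complex.Im (Z w)
      + complex.Im (Y w) * complex.Re (Z w))).
    by apply: measurable_funD; exact: measurable_funM.
  by apply/funext => w; case: (Y w) => ? ?; case: (Z w).
Qed.

Lemma measurable_parts_conj Y : measurable_parts Y ->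
  measurable_parts (fun w => conjc (Y w)).
Proof.
move=> [Y1 Y2]; split.
- rewrite (_ : (fun w => _) = (fun w => complex.Re (Y w)))//.
  by apply/funext => w; case: (Y w).
- rewrite (_ : (fun w => _) = (fun w => - complex.Im (Y w))).
    exact: measurable_funN.
  by apply/funext => w; case: (Y w).
Qed.

Lemma measurable_parts_sum (J : Type) (s : seq J) (F : J -> T -> R[i]) :
  (forall j, measurable_parts (F j)) ->
  measurable_parts (fun w => \sum_(j <- s) F j w).
Proof.
move=> mF; elim: s => [|j s IH].
  by under eq_fun do rewrite big_nil; exact: measurable_parts_cst.
by under eq_fun do rewrite big_cons; exact: measurable_partsD.
Qed.

Lemma measurable_nsq Y : measurable_parts Y -> measurable_fun setT (fun w => nsq (Y w)).
Proof.
by move=> [Y1 Y2]; apply: measurable_funD; exact: measurable_funX.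
Qed.

Lemma measurable_le_set (f g : T -> R) : measurable_fun setT f ->
  measurable_fun setT g -> measurable [set w | f w <= g w].
Proof. by move=> mf mg; rewrite -[X in measurable X]setTI; exact: measurable_fun_le. Qed.

Lemma measurable_lt_set (f g : T -> R) : measurable_fun setT f ->
  measurable_fun setT g -> measurable [set w | f w < g w].
Proof.
move=> mf mg; rewrite (_ : [set _ | _] = ~` [set w | g w <= f w]).
  by apply: measurableC; exact: measurable_le_set.
by apply/seteqP; split => w /=; rewrite ltNge => /negP.
Qed.

Lemma measurable_truncn (f : T -> R) k : measurable_fun setT f ->
  measurable [set w | Num.truncn (f w) = k].
Proof.
move=> mf.
have below n : measurable [set w | (Num.truncn (f w) <= n)%N].
  under eq_fun do rewrite truncn_le_nat.
  by apply: measurable_lt_set => //; exact: measurable_cst.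
case: k => [|k].
  rewrite (_ : [set _ | _] = [set w | (Num.truncn (f w) <= 0)%N]); first exact: below.
  by apply/seteqP; split => w /=; rewrite leqn0 => /eqP.
rewrite (_ : [set _ | _] = [set w | (Num.truncn (f w) <= k.+1)%N]
    `&` ~` [set w | (Num.truncn (f w) <= k)%N]).
  by apply: measurableI => //; exact: measurableC.
apply/seteqP; split => w /=; first by move=> ->; split=> //; rewrite ltnn.
by case=> h1 /negP; rewrite -ltnNge => h2; apply/eqP; rewrite eqn_leq h1 h2.
Qed.

End MeasurableComplex.

(** * Rounding to a finite grid *)

Section Grid.
Variables (R : realType) (K : R) (N : nat).
Hypothesis K_gt0 : 0 < K.
Hypothesis N_gt0 : (0 < N)%N.

Let NR : 0 < N%:R :> R. Proof. by rewrite ltr0n. Qed.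

Definition grid_size := Num.truncn (2 * K * N%:R).

Definition cell_index (x : R) : 'I_grid_size.+1 := inord (Num.truncn ((x + K) * N%:R)).

Definition grid := option ('I_grid_size.+1 * 'I_grid_size.+1).

(** [None] collects the values of modulus at least [K]: truncation and rounding
    are done at once, so that the rounded variable has finitely many values. *)
Definition to_grid (z : R[i]) : grid :=
  if nsq z < K ^+ 2 then Some (cell_index (complex.Re z), cell_index (complex.Im z))
  else None.

Definition grid_coord (j : 'I_grid_size.+1) : R := j%:R / N%:R - K.

Definition of_grid (v : grid) : R[i] :=
  if v is Some (j, l) then grid_coord j +i* grid_coord l else 0.

Lemma grid_coord_bound j : grid_coord j ^+ 2 <= K ^+ 2.
Proof.
have h : j%:R <= 2 * K * N%:R.
  have := ltn_ord j; rewrite ltnS /grid_size => jN.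
  have /andP[h _] := truncn_itv (mulr_ge0 (mulr_ge0 (ler0n _ 2) (ltW K_gt0)) (ltW NR)).
  by apply: le_trans h; rewrite ler_nat.
have h1 : j%:R / N%:R <= 2 * K by rewrite ler_pdivrMr.
have h0 : 0 <= j%:R / N%:R :> R by rewrite divr_ge0.
rewrite /grid_coord; move: (_ / _) h0 h1 => x h0 h1.
by rewrite !expr2; nra.
Qed.

Lemma of_grid_bound v : nsq (of_grid v) <= 2 * K ^+ 2.
Proof.
case: v => [[j l]|] /=; last by rewrite nsq0 mulr_ge0// sqr_ge0.
by rewrite /nsq /=; have := grid_coord_bound j; have := grid_coord_bound l; lra.
Qed.

Lemma grid_coord_near x : x ^+ 2 < K ^+ 2 ->
  x - N%:R^-1 <= grid_coord (cell_index x) <= x.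
Proof.
move=> xK; have /andP[x1 x2] : - K < x < K.
  by rewrite -ltr_norml -(ltr_pXn2r (n := 2))// ?nnegrE ?normr_ge0 ?(ltW K_gt0)// real_normK ?num_real.
have h0 : 0 <= (x + K) * N%:R by rewrite mulr_ge0// ?(ltW NR)//; lra.
have /andP[h1 h2] := truncn_itv h0.
rewrite /grid_coord /cell_index inordK; last first.
  rewrite ltnS /grid_size; apply: le_truncn.
  by rewrite ler_wpM2r ?(ltW NR)//; lra.
move: h1 h2; rewrite -natr1; move: (_%:R) => j.
rewrite -ler_pdivrMr// -ltr_pdivlMr// mulrDl mul1r => h1 h2.
by apply/andP; split; lra.
Qed.

Lemma to_grid_measurable d (T : measurableType d) (Y : T -> R[i]) :
  measurable_parts Y -> forall v, measurable ((to_grid \o Y) @^-1` [set v]).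
Proof.
move=> mY v; have [Y1 Y2] := mY.
have mcell (f : T -> R) j : measurable_fun setT f -> measurable [set w | cell_index (f w) = j].
  move=> mf; rewrite (_ : [set _ | _] = \bigcup_(k in [set k | inord k = j])
     [set w | Num.truncn ((f w + K) * N%:R) = k]).
    apply: bigcup_measurable => k _; apply: measurable_truncn.
    by apply: measurable_funM => //; apply: measurable_funD.
  apply/seteqP; split => w /=; first by move=> h; exists (Num.truncn ((f w + K) * N%:R)).
  by case=> k /= kj fk; rewrite /cell_index fk.
have mball : measurable [set w | nsq (Y w) < K ^+ 2].
  by apply: measurable_lt_set; [exact: measurable_nsq|exact: measurable_cst].
case: v => [[j l]|].
  rewrite (_ : _ @^-1` _ = [set w | nsq (Y w) < K ^+ 2] `&`
    ([set w | cell_index (complex.Re (Y w)) = j] `&` [set w | cell_index (complex.Im (Y w)) = l])).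
    by apply: measurableI => //; apply: measurableI; exact: mcell.
  apply/seteqP; split => w /=; rewrite /to_grid.
    by case: ifP => // _ [].
  by case=> -> [-> ->].
rewrite (_ : _ @^-1` _ = ~` [set w | nsq (Y w) < K ^+ 2]); first exact: measurableC.
apply/seteqP; split => w /=; rewrite /to_grid; first by case: ifP.
by move=> /negP/negbTE ->.
Qed.

End Grid.

(** * Second moment of the truncated part *)

Section TailMoment.
Variables (R : realType) (alpha a b : R).
Hypotheses (alpha_gt0 : 0 < alpha) (a_gt0 : 0 < a) (b_gt0 : 0 < b).

Definition growth_const : R := (4 * alpha / b) `^ alpha.

Lemma powR_le_expR y : 0 <= y -> y `^ alpha <= growth_const * expR (b * y / 4).
Proof.
move=> y0; have h : y <= 4 * alpha / b * expR (b * y / (4 * alpha)).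
  have e := expR_ge1Dx (b * y / (4 * alpha)).
  have c0 : 0 < 4 * alpha / b by rewrite divr_gt0// mulr_gt0.
  have -> : y = 4 * alpha / b * (b * y / (4 * alpha)) by field; rewrite !gt_eqF.
  rewrite ler_pM2l//; move: e; rewrite (_ : 4 * alpha / b * (b * y / (4 * alpha)) = y).
    by move=> e; lra.
  by field; rewrite !gt_eqF.
have c0 : 0 <= 4 * alpha / b by rewrite divr_ge0 ?mulr_ge0// ltW.
apply: (@le_trans _ _ ((4 * alpha / b * expR (b * y / (4 * alpha))) `^ alpha)).
  by rewrite ge0_ler_powR ?nnegrE ?(ltW alpha_gt0)// mulr_ge0 ?expR_ge0.
rewrite powRM ?expR_ge0// -expRM /growth_const.
rewrite (_ : b * y / (4 * alpha) * alpha = b * y / 4)//.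
by field; rewrite gt_eqF.
Qed.

Definition tail_const : R :=
  growth_const ^+ 2 * a * expR (b / 2) / (1 - expR (- (b / 2))).

Lemma expR_half_lt1 : expR (- (b / 2)) < 1.
Proof. by rewrite expR_lt1 oppr_lt0 divr_gt0. Qed.

Context d (T : measurableType d) (P : probability T R) (Y : T -> R[i]).
Hypothesis mY : measurable_parts Y.
Hypothesis Y_tail : forall t : R, 0 < t ->
  (P [set w | (t `^ alpha <= normc (Y w))%R] <= (a * expR (- (b * t)))%:E)%E.

Definition tail_part (K : R) (w : T) : R := nsq (Y w) * (K ^+ 2 <= nsq (Y w))%R%:R.

Lemma tail_part_ge0 K w : 0 <= tail_part K w.
Proof. by rewrite mulr_ge0// nsq_ge0. Qed.

Lemma le_normc_nsq (K : R) z : 0 <= K -> (K <= normc z) = (K ^+ 2 <= nsq z).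
Proof. by move=> K0; rewrite -normc_sqr ler_pXn2r// nnegrE ?normc_nneg. Qed.

Lemma measurable_tail_set K : measurable [set w | K ^+ 2 <= nsq (Y w)].
Proof. by apply: measurable_le_set; [exact: measurable_cst|exact: measurable_nsq]. Qed.

Lemma tail_partE K :
  tail_part K = fun w => nsq (Y w) * \1_[set w | K ^+ 2 <= nsq (Y w)] w.
Proof.
apply/funext => w; rewrite /tail_part indicE; congr (_ * (nat_of_bool _)%:R).
by apply/idP/idP; rewrite inE.
Qed.

Lemma measurable_tail_part K : measurable_fun setT (tail_part K).
Proof.
rewrite tail_partE; apply: measurable_funM; first exact: measurable_nsq.
exact/measurable_indicP/measurable_tail_set.
Qed.

Variable M : R.
Hypothesis M_gt0 : 0 < M.

Let shell k w : R := ((M + k.+1%:R) `^ alpha) ^+ 2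
   * \1_[set w | ((M + k%:R) `^ alpha) ^+ 2 <= nsq (Y w)] w.

Let shell_ge0 k w : 0 <= shell k w.
Proof. by rewrite /shell mulr_ge0 ?sqr_ge0. Qed.

(** A value of modulus [W `^ alpha] with [W >= M] lies in the shell whose index is
    the integer part of [W - M]. *)
Lemma tail_part_le_shells w :
  ((tail_part (M `^ alpha) w)%:E <= \sum_(0 <= k <oo) (shell k w)%:E)%E.
Proof.
rewrite /tail_part; case: (boolP (_ <= _)) => h; last first.
  by rewrite mulr0; apply: nneseries_ge0 => k _ _; rewrite lee_fin.
rewrite mulr1; move: h; rewrite -le_normc_nsq ?powR_ge0// => h.
set u := normc (Y w) in h *; pose W := u `^ alpha^-1.
have u0 : 0 <= u by exact: normc_nneg.
have uW : W `^ alpha = u.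
  by rewrite /W -powRrM mulVf ?gt_eqF// powRr1.
have W0 : 0 <= W by exact: powR_ge0.
have MW : M <= W.
  rewrite leNgt; apply/negP => WM; move: h; rewrite leNgt => /negP; apply.
  by rewrite -uW gt0_ltr_powR// nnegrE// ltW.
pose k := Num.truncn (W - M).
have /andP[k1 k2] : k%:R <= W - M < k.+1%:R by apply: truncn_itv; lra.
apply: (@le_trans _ _ (shell k w)%:E).
  rewrite lee_fin /shell indicE mem_set /=; last first.
    rewrite -le_normc_nsq ?powR_ge0// -/u -uW ge0_ler_powR ?nnegrE ?(ltW alpha_gt0)//.
      by rewrite addr_ge0// ltW.
    by lra.
  rewrite mulr1 -normc_sqr ler_pXn2r ?nnegrE ?normc_nneg ?powR_ge0//.
  rewrite -/u -uW ge0_ler_powR ?nnegrE ?(ltW alpha_gt0)//; last by lra.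
  by rewrite addr_ge0// ltW.
apply: le_trans (nneseries_lim_ge k.+1 _); last by move=> *; rewrite lee_fin.
rewrite big_nat_recr //= leeDr//.
by apply: sume_ge0 => *; rewrite lee_fin.
Qed.

(** On the shell of index [k], half of the exponential tail [expR (- b * (M + k))]
    absorbs the polynomial size of the variable; the other half gives the
    geometric series and the decay in [M]. *)
Lemma tail_second_moment :
  (\int[P]_w (tail_part (M `^ alpha) w)%:E
     <= (tail_const * expR (- (b * M / 2)))%:E)%E.
Proof.
have mshell k : measurable_fun setT (shell k).
  apply: measurable_funM; first exact: measurable_cst.
  exact/measurable_indicP/measurable_tail_set.
have mshellE k : measurable_fun setT (fun w => (shell k w)%:E) by exact/measurable_EFinP.
apply: (@le_trans _ _ (\int[P]_w (\sum_(0 <= k <oo) (shell k w)%:E))%E).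
  apply: ge0_le_integral => //.
  - by move=> w _; rewrite lee_fin tail_part_ge0.
  - exact/measurable_EFinP/measurable_tail_part.
  - by apply: ge0_emeasurable_sum => // *; rewrite lee_fin.
  - by move=> w _; exact: tail_part_le_shells.
rewrite integral_nneseries//; last by move=> *; rewrite lee_fin.
set r := expR (- (b / 2)).
have r1 : r < 1 by exact: expR_half_lt1.
have r0 : 0 < r by exact: expR_gt0.
set c := growth_const ^+ 2 * a * expR (b / 2) * expR (- (b * M / 2)).
have c0 : 0 <= c.
  by rewrite !mulr_ge0 ?expR_ge0 ?powR_ge0// ltW.
have term k : (\int[P]_w (shell k w)%:E <= (geometric c r k)%:E)%E.
  rewrite /shell; under eq_integral do rewrite EFinM.
  rewrite ge0_integralZl_EFin ?sqr_ge0//; last first.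
    exact/measurable_EFinP/measurable_indicP/measurable_tail_set.
  rewrite integral_indic// ?setIT; last exact: measurable_tail_set.
  have Mk : 0 < M + k%:R by rewrite ltr_wpDr.
  have := Y_tail Mk; rewrite (_ : [set _ | _] =
     [set w | ((M + k%:R) `^ alpha) ^+ 2 <= nsq (Y w)]); last first.
    by apply/seteqP; split => w /=; rewrite le_normc_nsq ?powR_ge0.
  move=> h; apply: le_trans (lee_wpmul2l _ h) _; first by rewrite lee_fin sqr_ge0.
  rewrite -EFinM lee_fin.
  have g : (M + k.+1%:R) `^ alpha <= growth_const * expR (b * (M + k.+1%:R) / 4).
    by apply: powR_le_expR; rewrite addr_ge0// ltW.
  apply: (@le_trans _ _ ((growth_const * expR (b * (M + k.+1%:R) / 4)) ^+ 2
      * (a * expR (- (b * (M + k%:R)))))).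
    rewrite ler_wpM2r ?mulr_ge0 ?expR_ge0 ?(ltW a_gt0)//.
    by rewrite ler_pXn2r// nnegrE ?powR_ge0// mulr_ge0 ?expR_ge0 ?powR_ge0.
  have expo : expR (b * (M + k.+1%:R) / 4) ^+ 2 * expR (- (b * (M + k%:R))) =
      expR (b / 2) * expR (- (b * M / 2)) * r ^+ k.
    rewrite /r -expRM_natr -expRM_natl -!expRD; congr expR.
    by rewrite -natr1; field.
  rewrite /geometric /= /c exprMn; apply: le_of_eq.
  transitivity (growth_const ^+ 2 * a *
    (expR (b * (M + k.+1%:R) / 4) ^+ 2 * expR (- (b * (M + k%:R))))); first by ring.
  by rewrite expo; ring.
apply: (@le_trans _ _ (\sum_(0 <= k <oo) (geometric c r k)%:E)%E).
  apply: lee_nneseries => // k _ _; apply: integral_ge0 => w _; by rewrite lee_fin.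
apply: lime_le.
  by apply: is_cvg_nneseries => k _ _; rewrite lee_fin /geometric /= mulr_ge0// exprn_ge0// ltW.
apply: nearW => k; rewrite sumEFin lee_fin.
have := @geometric_le_lim _ k c r c0 r0; rewrite ger0_norm ?(ltW r0)// => /(_ r1).
rewrite /series /= => /le_trans; apply.
apply: le_of_eq.
by rewrite /tail_const /c -/r; field; rewrite gt_eqF// subr_gt0.
Qed.

End TailMoment.

(** * Mean and variance of the rounded variable *)

Section RoundedMoments.
Context d (T : measurableType d) (R : realType) (P : probability T R).
Variables (Y : T -> R[i]) (K : R) (N : nat).
Hypothesis mY : measurable_parts Y.
Hypothesis K_ge1 : 1 <= K.
Hypothesis N_gt0 : (0 < N)%N.
Hypothesis iRe : P.-integrable setT (fun w => (complex.Re (Y w))%:E).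
Hypothesis iIm : P.-integrable setT (fun w => (complex.Im (Y w))%:E).
Hypothesis insq : P.-integrable setT (fun w => (nsq (Y w))%:E).
Hypothesis mean_Re : \int[P]_w complex.Re (Y w) = 0.
Hypothesis mean_Im : \int[P]_w complex.Im (Y w) = 0.
Hypothesis mean_nsq : \int[P]_w nsq (Y w) = 1.

Let K_gt0 : 0 < K. Proof. by apply: lt_le_trans K_ge1. Qed.
Let Ninv_ge0 : 0 <= N%:R^-1 :> R. Proof. by rewrite invr_ge0. Qed.

Definition cell w := to_grid K N (Y w).

Lemma measurable_cell v : measurable (cell @^-1` [set v]).
Proof. exact: to_grid_measurable. Qed.

Lemma Re_sqr_le (z : R[i]) : complex.Re z ^+ 2 <= nsq z.
Proof. by rewrite /nsq lerDl sqr_ge0. Qed.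

Lemma Im_sqr_le (z : R[i]) : complex.Im z ^+ 2 <= nsq z.
Proof. by rewrite /nsq lerDr sqr_ge0. Qed.

Lemma cell_cases w :
  (nsq (Y w) < K ^+ 2 /\ tail_part Y K w = 0 /\
   cell w = Some (cell_index K N (complex.Re (Y w)), cell_index K N (complex.Im (Y w))))
  \/ (K ^+ 2 <= nsq (Y w) /\ tail_part Y K w = nsq (Y w) /\ cell w = None).
Proof.
rewrite /tail_part /cell /to_grid; case: ltP => h; [left|right];
  by rewrite ?mulr0 ?mulr1.
Qed.

(** Since [K >= 1], on the truncated part the modulus is at most its square: the
    error on the mean is controlled by the same tail mass as that on the variance. *)
Lemma abs_le_sqr (x y : R) : 1 <= y -> x ^+ 2 <= y -> `|x| <= y.
Proof. by move=> y1 xy; rewrite ler_norml; apply/andP; split; move: xy; rewrite expr2; nra. Qed.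

Lemma of_cell_near (w : T) : nsq (Y w) < K ^+ 2 ->
  [/\ `|complex.Re (of_grid (cell w)) - complex.Re (Y w)| <= N%:R^-1,
      `|complex.Im (of_grid (cell w)) - complex.Im (Y w)| <= N%:R^-1 &
      `|nsq (of_grid (cell w)) - nsq (Y w)| <= 4 * K * N%:R^-1].
Proof.
move=> h; case: (cell_cases w) => -[h' [_ ->]]; last by move: h; rewrite ltNge h'.
have x2 := Re_sqr_le (Y w); have y2 := Im_sqr_le (Y w); rewrite /nsq /=.
move: (complex.Re _) (complex.Im _) h x2 y2 => x y; rewrite /nsq => h x2 y2.
have xK : x ^+ 2 < K ^+ 2 by lra.
have yK : y ^+ 2 < K ^+ 2 by lra.
have /andP[x3 x4] := grid_coord_near K_gt0 N_gt0 xK.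
have /andP[y3 y4] := grid_coord_near K_gt0 N_gt0 yK.
have x5 := grid_coord_bound K_gt0 N_gt0 (cell_index K N x).
have y5 := grid_coord_bound K_gt0 N_gt0 (cell_index K N y).
move: (grid_coord (cell_index K N x)) x3 x4 x5 => u x3 x4 x5.
move: (grid_coord (cell_index K N y)) y3 y4 y5 => v y3 y4 y5.
have i0 := Ninv_ge0; move: (_^-1) i0 x3 y3 => e i0 x3 y3.
have K0 := K_gt0.
have bound (r q : R) : q ^+ 2 < K ^+ 2 -> r ^+ 2 <= K ^+ 2 -> q - e <= r -> r <= q ->
    `|r ^+ 2 - q ^+ 2| <= 2 * K * e.
  move=> qK rK qr rq.
  have -> : r ^+ 2 - q ^+ 2 = (r - q) * (r + q) by ring.
  rewrite normrM [2 * K * e]mulrC; apply: ler_pM; rewrite ?normr_ge0// ler_norml; apply/andP; split; try lra.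
    by move: qK rK; rewrite !expr2; nra.
  by move: qK rK; rewrite !expr2; nra.
split; try by rewrite ler_norml; apply/andP; split; lra.
have := bound u x xK x5 x3 x4; have := bound v y yK y5 y3 y4.
rewrite !ler_norml => /andP[? ?] /andP[? ?]; apply/andP; split; lra.
Qed.

Lemma tail_part_integrable : P.-integrable setT (fun w => (tail_part Y K w)%:E).
Proof.
apply: le_integrable insq => //.
  exact/measurable_EFinP/measurable_tail_part.
move=> w _ /=; rewrite lee_fin !ger0_norm ?nsq_ge0 ?tail_part_ge0//.
by rewrite /tail_part; case: (K ^+ 2 <= _); rewrite ?mulr1 ?mulr0 ?lexx ?nsq_ge0.
Qed.

Lemma Rintegral_near (F G H : T -> R) (c : R) :
  P.-integrable setT (fun w => (F w)%:E) -> P.-integrable setT (fun w => (G w)%:E) ->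
  P.-integrable setT (fun w => (H w)%:E) ->
  (forall w, `|F w - G w| <= c + H w) ->
  `|\int[P]_w F w - \int[P]_w G w| <= c + \int[P]_w H w.
Proof.
move=> iF iG iH FG; have ic := finite_measure_integrable_cst P c (@measurableT _ T).
have iFG : P.-integrable setT (fun w => (F w - G w)%:E).
  by under eq_fun do rewrite EFinB; exact: integrableB.
have icH : P.-integrable setT (fun w => (c + H w)%:E).
  by under eq_fun do rewrite EFinD; exact: integrableD.
rewrite -RintegralB//; apply: le_trans (le_normr_Rintegral measurableT iFG) _.
have -> : c + \int[P]_w H w = \int[P]_w (c + H w).
  by rewrite RintegralD// Rintegral_cst// [X in fine X](probability_setT P) mulr1.
apply: le_Rintegral => //.
by have := integrable_norm iFG.
Qed.

Definition tail_mass : R := \int[P]_w tail_part Y K w.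

Definition rounding_error : R := 4 * K * N%:R^-1 + tail_mass.

Lemma tail_mass_ge0 : 0 <= tail_mass.
Proof. by apply: Rintegral_ge0 => w _; exact: tail_part_ge0. Qed.

Lemma rounding_error_ge : N%:R^-1 + tail_mass <= rounding_error.
Proof. by rewrite lerD2r ler_peMl//; have := K_ge1; lra. Qed.

Definition rounded_mean : R[i] :=
  (\sum_v law P cell v * complex.Re (of_grid v)) +i*
  (\sum_v law P cell v * complex.Im (of_grid v)).

Let near_integral (g : R[i] -> R) :
  P.-integrable setT (fun w => (g (Y w))%:E) ->
  forall c, (forall w, `|g (of_grid (cell w)) - g (Y w)| <= c + tail_part Y K w) ->
  `|\sum_v law P cell v * g (of_grid v) - \int[P]_w g (Y w)| <= c + tail_mass.
Proof.
move=> ig c h; rewrite -(Rintegral_law P measurable_cell (fun v => g (of_grid v))).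
apply: Rintegral_near => //; last exact: tail_part_integrable.
exact: (integrable_law P measurable_cell (fun v => g (of_grid v))).
Qed.

Lemma rounded_mean_Re : `|complex.Re rounded_mean| <= rounding_error.
Proof.
apply: le_trans rounding_error_ge; rewrite /= -[X in `|X|]subr0 -[X in `|_ - X|]mean_Re.
apply: (@near_integral (@complex.Re R)) => // w; case: (cell_cases w) => -[h [-> e]].
  by rewrite addr0; have [] := of_cell_near h.
rewrite e /= sub0r normrN -[leLHS]add0r lerD//.
by apply: abs_le_sqr; [have := K_ge1; move: h; rewrite expr2; nra|exact: Re_sqr_le].
Qed.

Lemma rounded_mean_Im : `|complex.Im rounded_mean| <= rounding_error.
Proof.
apply: le_trans rounding_error_ge; rewrite /= -[X in `|X|]subr0 -[X in `|_ - X|]mean_Im.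
apply: (@near_integral (@complex.Im R)) => // w; case: (cell_cases w) => -[h [-> e]].
  by rewrite addr0; have [] := of_cell_near h.
rewrite e /= sub0r normrN -[leLHS]add0r lerD//.
by apply: abs_le_sqr; [have := K_ge1; move: h; rewrite expr2; nra|exact: Im_sqr_le].
Qed.

Lemma rounded_nsq_near :
  `|\sum_v law P cell v * nsq (of_grid v) - 1| <= rounding_error.
Proof.
rewrite -mean_nsq; apply: (@near_integral (@nsq R)) => // w; case: (cell_cases w) => -[h [-> e]].
  by rewrite addr0; have [] := of_cell_near h.
rewrite e /= nsq0 sub0r normrN ger0_norm ?nsq_ge0// lerDr.
by rewrite !mulr_ge0// ltW.
Qed.

(** Truncation destroys the exact centering that integrating out coordinates
    requires; it is restored by subtracting the tiny mean. *)
Definition centered_value (v : grid K N) : R[i] := of_grid v - rounded_mean.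

Lemma centered_value_mean0 x : \sum_v law P cell v * dot (centered_value v) x = 0.
Proof.
have s1 := law_sum1 P measurable_cell.
rewrite (eq_bigr (fun v => complex.Re x * (law P cell v * complex.Re (of_grid v))
   + complex.Im x * (law P cell v * complex.Im (of_grid v))
   - dot rounded_mean x * law P cell v)); last first.
  move=> v _; rewrite /centered_value dotC.
  by case: (of_grid v) => p q; case: rounded_mean => m m'; rewrite /dot /=; ring.
rewrite sumrB big_split /= -!mulr_sumr s1 /dot /rounded_mean /=; ring.
Qed.

Lemma centered_second_moment :
  \sum_v law P cell v * nsq (centered_value v) =
  \sum_v law P cell v * nsq (of_grid v) - nsq rounded_mean.
Proof.
have s1 := law_sum1 P measurable_cell.
rewrite (eq_bigr (fun v => law P cell v * nsq (of_grid v)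
   - 2 * complex.Re rounded_mean * (law P cell v * complex.Re (of_grid v))
   - 2 * complex.Im rounded_mean * (law P cell v * complex.Im (of_grid v))
   + nsq rounded_mean * law P cell v)); last first.
  move=> v _; rewrite /centered_value.
  by case: (of_grid v) => p q; case: rounded_mean => m m'; rewrite /nsq /=; ring.
rewrite big_split !sumrB /= -!mulr_sumr s1 /nsq /rounded_mean /=; ring.
Qed.

Lemma rounded_mean_nsq_le : nsq rounded_mean <= 2 * rounding_error ^+ 2.
Proof.
have := rounded_mean_Re; have := rounded_mean_Im.
have sq (x : R) : `|x| <= rounding_error -> x ^+ 2 <= rounding_error ^+ 2.
  by move=> h; rewrite -real_normK ?num_real// ler_pXn2r// nnegrE (le_trans _ h).
by rewrite /nsq => /sq h1 /sq h2; lra.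
Qed.

Hypothesis error_le1 : rounding_error <= 1.

Lemma rounding_error_ge0 : 0 <= rounding_error.
Proof. by rewrite addr_ge0 ?tail_mass_ge0// !mulr_ge0// ltW. Qed.

Lemma centered_second_moment_near :
  `|\sum_v law P cell v * nsq (centered_value v) - 1| <= 3 * rounding_error.
Proof.
rewrite centered_second_moment.
have := rounded_nsq_near; have := rounded_mean_nsq_le; have := nsq_ge0 rounded_mean.
have := rounding_error_ge0; have := error_le1; move: rounding_error => e e1 e0.
move: (nsq _) (\sum_v _) => m s m0 me; rewrite !ler_norml => /andP[s1 s2].
by apply/andP; split; move: me; rewrite expr2; nra.
Qed.

Lemma centered_value_bound v : nsq (centered_value v) <= 8 * K ^+ 2.
Proof.
have h1 := of_grid_bound K_gt0 N_gt0 v; have h2 := rounded_mean_nsq_le.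
have h3 : rounding_error ^+ 2 <= K ^+ 2.
  have := rounding_error_ge0; have := error_le1; have := K_ge1; rewrite !expr2; nra.
have : nsq (centered_value v) <= 2 * nsq (of_grid v) + 2 * nsq rounded_mean.
  rewrite /centered_value; case: (of_grid v) => p q; case: rounded_mean => m m'.
  rewrite /nsq /=; have := sqr_ge0 (p + m); have := sqr_ge0 (q + m').
  by rewrite !expr2; lra.
by lra.
Qed.

Lemma centered_cell_near w : nsq (Y w) < K ^+ 2 ->
  nsq (Y w - centered_value (cell w)) <= (3 * rounding_error) ^+ 2.
Proof.
move=> h; have [h1 h2 _] := of_cell_near h.
have h3 := rounded_mean_Re; have h4 := rounded_mean_Im.
have h5 : N%:R^-1 <= rounding_error.
  by apply: le_trans rounding_error_ge; rewrite lerDl tail_mass_ge0.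
move: h1 h2 h3 h4; rewrite /centered_value.
case: (of_grid _) => p q; case: (Y w) => x y; case: rounded_mean => m m' /=.
move: rounding_error h5 => e h5; move: (_^-1) h5 => e' h5.
rewrite /nsq /= !ler_norml => /andP[a1 a2] /andP[b1 b2] /andP[c1 c2] /andP[d1 d2].
have sq (u : R) : - (2 * e) <= u -> u <= 2 * e -> u ^+ 2 <= 4 * e ^+ 2.
  by move=> u1 u2; rewrite !expr2; nra.
have s1 : (x - (p - m)) ^+ 2 <= 4 * e ^+ 2 by apply: sq; lra.
have s2 : (y - (q - m')) ^+ 2 <= 4 * e ^+ 2 by apply: sq; lra.
have e2 := sqr_ge0 e.
have -> : (3 * e) ^+ 2 = 9 * e ^+ 2 by ring.
have -> : (x + - (p + - m)) = x - (p - m) by [].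
have -> : (y + - (q + - m')) = y - (q - m') by [].
by lra.
Qed.

End RoundedMoments.

(** * Spectral norm and perturbation of the quadratic form *)

Section NormcBounds.
Variable R : realType.

Lemma normc_sum (J : Type) (s : seq J) (Q : pred J) (F : J -> R[i]) :
  normc (\sum_(j <- s | Q j) F j) <= \sum_(j <- s | Q j) normc (F j).
Proof.
elim/big_ind2 : _ => [|x1 x2 y1 y2 h1 h2|//]; first by rewrite normc0.
by apply: le_trans (le_normcD _ _) _; exact: lerD.
Qed.

Lemma normcJ_conj (x : R[i]) : normc (conjc x) = normc x.
Proof. by case: x => x y; rewrite /= sqrrN. Qed.

Lemma normc_le (x : R[i]) (r : R) : 0 <= r -> nsq x <= r ^+ 2 -> normc x <= r.
Proof.
by move=> r0; rewrite -normc_sqr ler_pXn2r// nnegrE normc_nneg.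
Qed.

Lemma normc_real (r : R) : normc (r%:C) = `|r|.
Proof. by rewrite /= expr0n addr0 sqrtr_sqr. Qed.

End NormcBounds.

Section SpectralNorm.
Variables (R : realType) (n : nat) (A : 'M[R[i]]_n).
Local Notation S := (spectral_norm A).

Lemma euclidean_normE (v : 'cV[R[i]]_n) :
  euclidean_norm v = Num.sqrt (l2sq (fun i => v i 0)).
Proof. by congr Num.sqrt; apply: eq_bigr => i _; rewrite normc_sqr. Qed.

(** The supremum defining the spectral norm is a true one: each coordinate of the
    image of a unit vector is at most the sum of the moduli of a row. *)
Lemma spectral_set_bounded :
  has_sup [set euclidean_norm (A *m v) | v in [set v : 'cV[R[i]]_n | euclidean_norm v <= 1]].
Proof.
have e0 : euclidean_norm (0 : 'cV[R[i]]_n) <= 1.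
  by rewrite euclidean_normE /l2sq big1 ?sqrtr0// => i _; rewrite mxE nsq0.
split; first by exists (euclidean_norm (A *m 0)); exists 0.
exists (Num.sqrt (\sum_i (\sum_j normc (A i j)) ^+ 2)) => _ [v /= v1 <-].
rewrite euclidean_normE ler_sqrt; last by apply: sumr_ge0 => i _; exact: sqr_ge0.
apply: ler_sum => i _; rewrite -normc_sqr.
rewrite ler_pXn2r ?nnegrE ?normc_nneg//; last by apply: sumr_ge0 => j _; exact: normc_nneg.
rewrite mxE; apply: le_trans (normc_sum _ _ _) _; apply: ler_sum => j _.
rewrite normcM ler_piMr ?normc_nneg//; apply: normc_le => //.
rewrite expr1n; apply: (@le_trans _ _ (l2sq (fun i => v i 0))).
  by rewrite /l2sq (bigD1 j)//= lerDl; apply: sumr_ge0 => k _; exact: nsq_ge0.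
move: v1; rewrite euclidean_normE -(ler_pXn2r (n := 2)) ?nnegrE ?sqrtr_ge0//.
by rewrite sqr_sqrtr ?l2sq_ge0// expr1n.
Qed.

Lemma spectral_norm_ge (v : 'cV[R[i]]_n) : euclidean_norm v <= 1 -> euclidean_norm (A *m v) <= S.
Proof. by move=> v1; apply: (ub_le_sup (proj2 spectral_set_bounded)); exists v. Qed.

Lemma spectral_norm_ge0 : 0 <= S.
Proof.
have e0 : euclidean_norm (0 : 'cV[R[i]]_n) <= 1.
  by rewrite euclidean_normE /l2sq big1 ?sqrtr0// => i _; rewrite mxE nsq0.
by apply: le_trans (spectral_norm_ge e0); rewrite euclidean_normE sqrtr_ge0.
Qed.

Lemma spectral_op_bound : op_bound (fun i j => A i j) (S ^+ 2).
Proof.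
move=> u; have [u0|u0] := ltP 0 (l2sq u); last first.
  have uz i : nsq (u i) = 0.
    apply/eqP; rewrite eq_le nsq_ge0 andbT; apply: le_trans u0.
    by rewrite /l2sq (bigD1 i)//= lerDl; apply: sumr_ge0 => k _; exact: nsq_ge0.
  rewrite (_ : l2sq (apply_mx _ _) = 0); last first.
    apply: big1 => i _; rewrite /apply_mx.
    apply/eqP; rewrite eq_le nsq_ge0 andbT -normc_sqr.
    rewrite (_ : normc _ = 0) ?expr0n//; apply/eqP; rewrite eq_le normc_nneg andbT.
    apply: le_trans (normc_sum _ _ _) _; rewrite big1// => j _.
    by rewrite normcM (_ : normc (u j) = 0) ?mulr0//; apply/eqP; rewrite -sqrf_eq0 normc_sqr uz.
  by rewrite mulr_ge0 ?sqr_ge0 ?l2sq_ge0.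
pose r := (Num.sqrt (l2sq u))^-1.
have r2 : r ^+ 2 * l2sq u = 1.
  by rewrite /r exprVn sqr_sqrtr ?mulVf ?gt_eqF// ltW.
pose v : 'cV[R[i]]_n := \col_i (r%:C * u i).
have v1 : euclidean_norm v <= 1.
  rewrite euclidean_normE (_ : l2sq _ = 1) ?sqrtr1// -r2 /l2sq mulr_sumr.
  by apply: eq_bigr => i _; rewrite mxE nsqZ.
have := spectral_norm_ge v1.
rewrite euclidean_normE -(ler_pXn2r (n := 2)) ?nnegrE ?sqrtr_ge0 ?spectral_norm_ge0//.
rewrite sqr_sqrtr ?l2sq_ge0// (_ : l2sq _ = r ^+ 2 * l2sq (apply_mx (fun i j => A i j) u)).
  move=> h; rewrite -[leLHS]mul1r -{1}r2 mulrAC.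
  by rewrite ler_wpM2r// ltW.
rewrite /l2sq mulr_sumr; apply: eq_bigr => i _; rewrite -nsqZ; congr nsq.
rewrite /apply_mx mulr_sumr mxE; apply: eq_bigr => j _.
by rewrite mxE mulrCA.
Qed.

Lemma entry_le_spectral i j : normc (A i j) <= S.
Proof.
apply: normc_le; first exact: spectral_norm_ge0.
exact: (op_bound_entry i j spectral_op_bound).
Qed.

Lemma frobenius_normE : frobenius_norm A ^+ 2 = \sum_i \sum_j nsq (A i j).
Proof.
rewrite /frobenius_norm sqr_sqrtr.
  by apply: eq_bigr => i _; apply: eq_bigr => j _; rewrite normc_sqr.
by apply: sumr_ge0 => i _; apply: sumr_ge0 => j _; exact: sqr_ge0.
Qed.

(** A nonzero entry of [A] bounds both norms from below. *)
Lemma norms_gt0 : A != 0 -> 0 < S /\ 0 < frobenius_norm A.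
Proof.
move=> A0; have [i [j Aij]] : exists i j, A i j != 0.
  apply: contrapT => h; move/negP: A0; apply; apply/eqP/matrixP => i j; rewrite mxE.
  by apply/eqP/negPn/negP => Aij; apply: h; exists i, j.
have N0 : 0 < normc (A i j).
  rewrite lt_neqAle normc_nneg andbT eq_sym; apply/negP => /eqP/eq0_normc/eqP.
  by rewrite (negbTE Aij).
split; first by apply: lt_le_trans (entry_le_spectral i j).
rewrite lt_neqAle sqrtr_ge0 andbT; apply/negP => /eqP F0.
have := frobenius_normE; rewrite -F0 expr0n /= => /esym/eqP.
rewrite psumr_eq0; last by move=> k _; apply: sumr_ge0 => l _; exact: nsq_ge0.
move=> /allP /(_ i (mem_index_enum _)) /=.
rewrite psumr_eq0; last by move=> l _; exact: nsq_ge0.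
move=> /allP /(_ j (mem_index_enum _)) /=.
by rewrite -normc_sqr sqrf_eq0 gt_eqF.
Qed.

Lemma quadratic_formE (x : 'cV[R[i]]_n) :
  quadratic_form A x = \sum_i \sum_j conjc (x i 0) * (A i j * x j 0).
Proof.
rewrite /quadratic_form mxE exchange_big; apply: eq_bigr => j _.
rewrite mxE mulr_suml; apply: eq_bigr => i _.
by rewrite !mxE mulrA.
Qed.

(** Crude: each of the [n ^+ 2] terms moves by at most [4 * K * e] times the
    spectral norm. The factor [n ^+ 2] is affordable because the error [e]
    comes from an exponential tail at a rate exceeding every multiple of [ln n]. *)
Lemma quadratic_form_perturb (x y : 'I_n -> R[i]) (sigma : 'I_n -> R) (K e : R) :
  1 <= K -> 0 <= e ->
  (forall i, normc (x i) <= K) -> (forall i, normc (y i) <= 3 * K) ->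
  (forall i, normc (x i - y i) <= e) -> (forall i, `|sigma i - 1| <= e) ->
  normc (((\sum_i \sum_j conjc (x i) * (A i j * x j)) - \tr A)
    - ((\sum_i \sum_j conjc (y i) * (A i j * y j)) - \sum_i A i i * (sigma i)%:C))
  <= 5 * n%:R ^+ 2 * K * S * e.
Proof.
move=> K1 e0 xK yK xy s1; have S0 := spectral_norm_ge0.
have -> : ((\sum_i \sum_j conjc (x i) * (A i j * x j)) - \tr A)
    - ((\sum_i \sum_j conjc (y i) * (A i j * y j)) - \sum_i A i i * (sigma i)%:C) =
  \sum_i (\sum_j (conjc (x i - y i) * A i j * x j + conjc (y i) * A i j * (x j - y j))
     + A i i * (sigma i - 1)%:C).
  rewrite big_split /= /mxtrace.
  have -> : \sum_i A i i * (sigma i - 1)%:C = \sum_i A i i * (sigma i)%:C - \sum_i A i i.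
    by rewrite -sumrB; apply: eq_bigr => i _; rewrite rmorphB mulrBr rmorph1 mulr1.
  have -> : \sum_i \sum_j (conjc (x i - y i) * A i j * x j + conjc (y i) * A i j * (x j - y j)) =
    \sum_i \sum_j conjc (x i) * (A i j * x j) - \sum_i \sum_j conjc (y i) * (A i j * y j).
    rewrite -sumrB; apply: eq_bigr => i _; rewrite -sumrB; apply: eq_bigr => j _.
    by rewrite rmorphB /=; ring.
  by ring.
apply: le_trans (normc_sum _ _ _) _.
apply: (@le_trans _ _ (\sum_(i < n) (5 * n%:R * K * S * e))); last first.
  by rewrite sumr_const card_ord -[leLHS]mulr_natr; apply: le_of_eq; ring.
apply: ler_sum => i _; apply: le_trans (le_normcD _ _) _.
apply: (@le_trans _ _ (n%:R * (4 * K * S * e) + S * e)); last first.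
  have n1 : 1 <= n%:R :> R by rewrite ler1n; case: (n) i => [[]|].
  have : S * e <= n%:R * (K * (S * e)).
    rewrite -[leLHS]mul1r -[leLHS]mul1r; apply: ler_pM => //; rewrite ?mulr_ge0//.
    by rewrite ler_wpM2r// mulr_ge0.
  by lra.
apply: lerD; last first.
  by rewrite normcM normc_real ler_pM ?normc_nneg ?entry_le_spectral.
apply: le_trans (normc_sum _ _ _) _.
apply: (@le_trans _ _ (\sum_(j < n) (4 * K * S * e))); last first.
  by rewrite sumr_const card_ord -[leLHS]mulr_natr mulrC.
apply: ler_sum => j _; apply: le_trans (le_normcD _ _) _.
have -> : 4 * K * S * e = e * S * K + 3 * K * S * e by ring.
apply: lerD; rewrite !normcM normcJ_conj.
  by rewrite !ler_pM ?mulr_ge0 ?normc_nneg ?entry_le_spectral.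
by rewrite !ler_pM ?mulr_ge0 ?normc_nneg ?entry_le_spectral.
Qed.

End SpectralNorm.

(** * The tail bound in a fixed dimension *)

Section FixedDimension.
Variables (R : realType) (alpha a b : R).
Hypotheses (alpha_gt0 : 0 < alpha) (a_gt0 : 0 < a) (b_gt0 : 0 < b).
Context d (T : measurableType d) (P : probability T R).
Variables (n : nat) (X : T -> 'cV[R[i]]_n) (A : 'M[R[i]]_n).
Hypothesis n_gt0 : (0 < n)%N.
Hypothesis mX : forall i : 'I_n, complex_rv (fun w => X w i 0).
Hypothesis X_indep :
  mutually_independent P (fun (i : 'I_n) w => complex_pair (X w i 0)).
Hypothesis X_int : forall i : 'I_n, complex_integrable P (fun w => X w i 0).
Hypothesis X_mean : forall i : 'I_n, complex_expectation P (fun w => X w i 0) = 0.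
Hypothesis X_var : forall i : 'I_n, complex_variance P (fun w => X w i 0) = 1%E.
Hypothesis X_tail : forall i : 'I_n, sub_exponential P alpha a b (fun w => X w i 0).

Let mp i : measurable_parts (fun w => X w i 0).
Proof. exact: complex_rvP. Qed.

Lemma coord_mean_Re i : \int[P]_w complex.Re (X w i 0) = 0.
Proof.
have := congr1 (@complex.Re R) (X_mean i); rewrite /complex_expectation /=.
by rewrite unlock.
Qed.

Lemma coord_mean_Im i : \int[P]_w complex.Im (X w i 0) = 0.
Proof.
have := congr1 (@complex.Im R) (X_mean i); rewrite /complex_expectation /=.
by rewrite unlock.
Qed.

Lemma coord_nsqE i : (\int[P]_w (nsq (X w i 0))%:E = 1)%E.
Proof.
rewrite -(X_var i) /complex_variance X_mean unlock.
by apply: eq_integral => w _; rewrite subr0 normc_sqr.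
Qed.

Lemma coord_nsq_integrable i : P.-integrable setT (fun w => (nsq (X w i 0))%:E).
Proof.
apply/integrableP; split; first exact/measurable_EFinP/measurable_nsq.
under eq_integral do rewrite gee0_abs ?lee_fin ?nsq_ge0//.
by rewrite coord_nsqE ltry.
Qed.

Lemma coord_mean_nsq i : \int[P]_w nsq (X w i 0) = 1.
Proof. by rewrite /Rintegral coord_nsqE. Qed.

Lemma coord_tail i (t : R) : 0 < t ->
  (P [set w | (t `^ alpha <= normc (X w i 0))%R] <= (a * expR (- (b * t)))%:E)%E.
Proof.
move=> t0; have := X_tail i t0; rewrite X_mean.
by under eq_set do rewrite subr0.
Qed.

Lemma measurable_quadratic_form : measurable_parts (fun w => quadratic_form A (X w)).
Proof.
under eq_fun do rewrite quadratic_formE.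
apply: measurable_parts_sum => i; apply: measurable_parts_sum => j.
apply: measurable_partsM; first exact: measurable_parts_conj.
by apply: measurable_partsM; first exact: measurable_parts_cst.
Qed.

(** The preimages of grid cells are Borel sets of the plane. *)
Lemma cells_independent (K : R) (N : nat) : 0 < K -> (0 < N)%N ->
  forall f : {ffun 'I_n -> grid K N},
  P [set w | forall i, cell (fun w => X w i 0) K N w = f i] =
  (\prod_i law P (cell (fun w => X w i 0) K N) (f i))%:E.
Proof.
move=> K0 N0 f.
pose B (i : 'I_n) := (to_grid K N \o (fun x : R * R => (x.1 +i* x.2)%C)) @^-1` [set f i].
have mB i : measurable (B i).
  by apply: to_grid_measurable => //; split; [exact: measurable_fst|exact: measurable_snd].
have BE i : (fun w => complex_pair (X w i 0)) @^-1` B i =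
    cell (fun w => X w i 0) K N @^-1` [set f i].
  by rewrite /B /cell /complex_pair /=; apply/seteqP; split => w /=; case: (X w i 0).
have := X_indep [set i : 'I_n | true]%SET mB.
rewrite (_ : \bigcap_(i in _) _ = [set w | forall i, cell (fun w => X w i 0) K N w = f i]).
  move=> ->; rewrite -prodEFin; apply: eq_big => [i|i _]; first by rewrite inE.
  rewrite BE /law fineK// fin_num_measure// -BE.
  have := mX i measurableT (mB i); by rewrite setTI.
apply/seteqP; split => w /=.
  move=> h i; have hi : B i (complex_pair (X w i 0)) by apply: h; rewrite /= inE.
  have : (cell (fun w => X w i 0) K N @^-1` [set f i]) w by rewrite -BE.
  by [].
move=> h i _; have : (cell (fun w => X w i 0) K N @^-1` [set f i]) w by exact: h.
by rewrite -BE.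
Qed.

Variables (t M : R).
Hypothesis t_gt0 : 0 < t.
Hypothesis M_ge1 : 1 <= M.
Hypothesis M_spectral : M `^ (2 * alpha + 1) * spectral_norm A <= t.
Hypothesis M_frobenius : M `^ (alpha + 1 / 2) * frobenius_norm A <= t.
Hypothesis M_large : 60 * n%:R ^+ 2 * (tail_const alpha a b * expR (- (b * M / 2))) <= 1.

Let K := M `^ alpha.
Let M_gt0 : 0 < M. Proof. exact: lt_le_trans M_ge1. Qed.
Let K_ge1 : 1 <= K.
Proof.
have M_nneg : M \is Num.nneg by exact: ltW.
by have := ge0_ler_powR (ltW alpha_gt0) ler01 M_nneg M_ge1; rewrite powR1.
Qed.
Let K_gt0 : 0 < K. Proof. exact: lt_le_trans K_ge1. Qed.

(** Outside the event that some coordinate has modulus at least [M `^ alpha], the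
    form differs by at most [t / 2] from that of the rounded and centered
    variables, whose squared moduli are bounded by [8 * M `^ (2 * alpha)]. The tail
    bound with parameter [mu] proportional to [M / t] then applies, the two
    lower bounds on [t] being what its hypothesis and its error term require. *)
Lemma quadratic_form_tail :
  (P [set w | (t <= normc (quadratic_form A (X w) - \tr A))%R] <=
    (n%:R * (a * expR (- (b * M))) + 4 * expR (- (M / (520 * 512))))%:E)%E.
Proof.
have nR : 1 <= n%:R :> R by rewrite ler1n.
have S0 := spectral_norm_ge0 A.
have F0 : 0 <= frobenius_norm A by exact: sqrtr_ge0.
have KKM : K ^+ 2 * M = M `^ (2 * alpha + 1).
  rewrite powRD; last by rewrite (gt_eqF M_gt0) implybT.
  by rewrite powRr1 ?(ltW M_gt0)// (mulrC 2 alpha) powRrM powR_mulrn ?powR_ge0.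
(* a mesh that makes the rounding part of the error at most [1 / (60 * n ^+ 2)],
   the bound that [M_large] gives for the tail mass *)
pose N := (Num.truncn (240 * n%:R ^+ 2 * K)).+1.
have N0 : (0 < N)%N by [].
have NK : 60 * n%:R ^+ 2 * (4 * K * N%:R^-1) <= 1.
  have h : 240 * n%:R ^+ 2 * K < N%:R by exact: truncnS_gt.
  rewrite (_ : 60 * n%:R ^+ 2 * (4 * K * N%:R^-1) = 240 * n%:R ^+ 2 * K / N%:R); last by ring.
  by rewrite ler_pdivrMr ?ltr0n// mul1r ltW.
pose err i := rounding_error P (fun w => X w i 0) K N.
have massi i : tail_mass P (fun w => X w i 0) K <= tail_const alpha a b * expR (- (b * M / 2)).
  have h := tail_second_moment alpha_gt0 a_gt0 b_gt0 (mp i) (coord_tail i) M_gt0.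
  have h0 : (0 <= \int[P]_w (tail_part (fun w => X w i 0) K w)%:E)%E.
    by apply: integral_ge0 => w _; rewrite lee_fin tail_part_ge0.
  rewrite -lee_fin /tail_mass /Rintegral fineK//.
  by rewrite ge0_fin_numE// (le_lt_trans h)// ltry.
have errn i : 30 * n%:R ^+ 2 * err i <= 1.
  have := ler_wpM2l (_ : 0 <= 60 * n%:R ^+ 2) (massi i).
  rewrite mulr_ge0 ?sqr_ge0// => /(_ isT) => h.
  rewrite /err /rounding_error.
  have {}h := le_trans h M_large; move: NK h.
  move: (4 * K / _) (tail_mass _ _ _) => u v; rewrite -!mulrA mulrDr.
  by move: (_ * u) (_ * v) => u' v'; lra.
have n2 : 1 <= n%:R ^+ 2 :> R by rewrite expr2; nra.
pose e : R := (10 * n%:R ^+ 2)^-1.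
have e_gt0 : 0 < e by rewrite invr_gt0; nra.
have erre i : 3 * err i <= e.
  rewrite /e -[leRHS]mul1r ler_pdivlMr; last by nra.
  by have := errn i; lra.
have err0 i : 0 <= err i by exact: rounding_error_ge0.
have err1 i : err i <= 1.
  have := errn i; have := err0 i; move: (err i) => r.
  by move: n2; move: (n%:R ^+ 2) => q; nra.
pose C i := cell (fun w => X w i 0) K N.
have mC i v : measurable (C i @^-1` [set v]) by exact: measurable_cell.
pose z i := centered_value P (fun w => X w i 0) (K := K) (N := N).
pose sigma i := second_moment (fun i => law P (C i)) z i.
have sigma1 i : `|sigma i - 1| <= e.
  apply: le_trans (erre i); apply: centered_second_moment_near => //.
  - exact: (proj1 (X_int i)).
  - exact: (proj2 (X_int i)).
  - exact: coord_nsq_integrable.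
  - exact: coord_mean_Re.
  - exact: coord_mean_Im.
  - exact: coord_mean_nsq.
  - exact: err1.
have z_bound : forall i v, nsq (z i v) <= 8 * K ^+ 2.
  move=> i v; apply: centered_value_bound => //.
  - exact: (proj1 (X_int i)).
  - exact: (proj2 (X_int i)).
  - exact: coord_nsq_integrable.
  - exact: coord_mean_Re.
  - exact: coord_mean_Im.
  - exact: err1.
have z_mean0 : forall i x, \sum_v law P (C i) v * dot (z i v) x = 0.
  move=> i x; exact: centered_value_mean0.
pose E := fun f : {ffun 'I_n -> grid K N} =>
  t / 2 <= normc (centered_chaos (fun i => law P (C i)) z (fun i j => A i j) f).
have split_event : [set w | (t <= normc (quadratic_form A (X w) - \tr A))%R] `<=`
   (\big[setU/set0]_(i < n) [set w | K ^+ 2 <= nsq (X w i 0)])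
    `|` [set w | E [ffun i => C i w]].
  move=> w /= tw; have [[i Ki]|small] := pselect (exists i : 'I_n, K ^+ 2 <= nsq (X w i 0)).
    by left; rewrite -bigcup_seq; exists i => //=; rewrite mem_index_enum.
  right => /=; rewrite /E.
  have small' i : nsq (X w i 0) < K ^+ 2.
    by rewrite ltNge; apply/negP => h; apply: small; exists i.
  pose y i := z i (C i w).
  have pert : normc ((quadratic_form A (X w) - \tr A)
      - ((\sum_i \sum_j conjc (y i) * (A i j * y j)) - \sum_i A i i * (sigma i)%:C))
      <= 5 * n%:R ^+ 2 * K * spectral_norm A * e.
    rewrite quadratic_formE; apply: quadratic_form_perturb => //; first exact: ltW.
    - by move=> i; apply: normc_le; [exact: ltW|exact: ltW].
    - move=> i; apply: normc_le; first by rewrite mulr_ge0// ltW.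
      apply: le_trans (z_bound _ _) _.
      by rewrite exprMn ler_wpM2r ?sqr_ge0//; lra.
    - move=> i; apply: normc_le; first exact: ltW.
      apply: (@le_trans _ _ ((3 * err i) ^+ 2)).
        apply: centered_cell_near => //.
        + exact: (proj1 (X_int i)).
        + exact: (proj2 (X_int i)).
        + exact: coord_nsq_integrable.
        + exact: coord_mean_Re.
        + exact: coord_mean_Im.
      rewrite ler_pXn2r// nnegrE ?(ltW e_gt0)//.
      by rewrite mulr_ge0.
  have small_pert : 5 * n%:R ^+ 2 * K * spectral_norm A * e <= t / 2.
    rewrite /e (_ : 5 * n%:R ^+ 2 * K * spectral_norm A / (10 * n%:R ^+ 2) =
       K * spectral_norm A / 2); last by field; rewrite pnatr_eq0 -lt0n.
    rewrite ler_pM2r//; apply: le_trans M_spectral; rewrite -KKM ler_wpM2r//.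
    by rewrite expr2 -mulrA ler_peMr ?(ltW K_gt0)//; have := K_ge1; have := M_ge1; nra.
  have -> : centered_chaos (fun i => law P (C i)) z (fun i j => A i j) [ffun i => C i w] =
     (\sum_i \sum_j conjc (y i) * (A i j * y j)) - \sum_i A i i * (sigma i)%:C.
    rewrite /centered_chaos; congr (_ - _); apply: eq_bigr => i _; apply: eq_bigr => j _.
    by rewrite !ffunE.
  set u := (X in normc X); have := le_normcD (quadratic_form A (X w) - \tr A - u) u.
  rewrite subrK => h.
  have := le_trans tw h; move: pert; rewrite -/u => pert.
  by lra.
have mbad i : measurable [set w | K ^+ 2 <= nsq (X w i 0)] by exact: measurable_tail_set.
have mE : measurable [set w | E [ffun i => C i w]].
  exact: (measurable_finite_event (N := C) mC).
have mbads : measurable (\big[setU/set0]_(i < n) [set w | K ^+ 2 <= nsq (X w i 0)]).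
  by apply: bigsetU_measurable.
have mevent : measurable [set w | (t <= normc (quadratic_form A (X w) - \tr A))%R].
  rewrite (_ : [set _ | _] = [set w | t ^+ 2 <= nsq (quadratic_form A (X w) + - \tr A)]); last first.
    by apply/seteqP; split => w /=; rewrite le_normc_nsq// ltW.
  apply: measurable_tail_set; apply: measurable_partsD; first exact: measurable_quadratic_form.
  exact: measurable_parts_cst.
apply: (@le_trans _ _ (P ((\big[setU/set0]_(i < n) [set w | K ^+ 2 <= nsq (X w i 0)])
    `|` [set w | E [ffun i => C i w]]))).
  by apply: le_measure; rewrite ?inE//; exact: measurableU.
apply: le_trans (measureU2 _ mbads mE) _.
rewrite EFinD; apply: leeD.
  apply: le_trans (measure_bigsetU_le _ _ _ mbad) _.
  apply: (@le_trans _ _ (\sum_(i < n) (a * expR (- (b * M)))%:E)%E).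
    apply: lee_sum => i _; have := coord_tail i M_gt0.
    rewrite (_ : [set _ | _] = [set w | K ^+ 2 <= nsq (X w i 0)])//.
    by apply/seteqP; split => w /=; rewrite le_normc_nsq// ltW.
  by rewrite sumEFin lee_fin sumr_const card_ord mulr_natl.
apply: le_trans (finite_event_le mC (cells_independent K_gt0 N0) E) _.
rewrite lee_fin /E.
(* [520] is the constant of the quadratic term in the tail bound; the factor
   [64] makes this term at most half of the linear one. *)
have c0 : 0 < 520 * 64 :> R by exact: mulr_gt0 (ltr0Sn _ _) (ltr0Sn _ _).
pose mu := M / t / (520 * 64).
have mu0 : 0 <= mu by exact: divr_ge0 (divr_ge0 (ltW M_gt0) (ltW t_gt0)) (ltW c0).
have sK : 0 <= 8 * K ^+ 2 by rewrite mulr_ge0 ?sqr_ge0.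
have e1 : e <= 1 by rewrite /e invf_le1//; nra.
have z_var i : \sum_v law P (C i) v * nsq (z i v) <= 2.
  have := sigma1 i; rewrite ler_norml => /andP[_]; rewrite /sigma /second_moment => h.
  by lra.
have muS : (128 * (8 * K ^+ 2) * mu) ^+ 2 * spectral_norm A ^+ 2 <= 1.
  rewrite -exprMn -[leRHS](expr1n _ 2).
  have -> : 128 * (8 * K ^+ 2) * mu * spectral_norm A =
    1024 / (520 * 64) * ((K ^+ 2 * M * spectral_norm A) / t).
    by rewrite /mu; field; rewrite gt_eqF.
  rewrite KKM; have h : M `^ (2 * alpha + 1) * spectral_norm A / t <= 1.
    by rewrite ler_pdivrMr// mul1r.
  have h0 : 0 <= M `^ (2 * alpha + 1) * spectral_norm A / t.
    by rewrite divr_ge0 ?mulr_ge0 ?powR_ge0// ltW.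
  move: (_ / t) h h0 => q q1 q0.
  by apply: lerXn2r; rewrite ?nnegrE; lra.
have t20 : 0 <= t / 2 by rewrite divr_ge0// ltW.
apply: le_trans (centered_chaos_tail (fun i v => law_ge0 P (C i) v)
   (fun i => law_sum1 P (mC i)) sK z_mean0 z_bound z_var (sqr_ge0 _)
   (spectral_op_bound A) mu0 t20 muS) _.
rewrite ler_pM2l// ler_expR -frobenius_normE.
have FM : frobenius_norm A ^+ 2 * (K ^+ 2 * M) <= t ^+ 2.
  have -> : frobenius_norm A ^+ 2 * (K ^+ 2 * M) = (M `^ (alpha + 1 / 2) * frobenius_norm A) ^+ 2.
    rewrite KKM exprMn mulrC; congr (_ * _).
    by rewrite -powR_mulrn ?powR_ge0// -powRrM; congr (_ `^ _); field.
  by rewrite ler_pXn2r ?nnegrE ?mulr_ge0 ?powR_ge0// ltW.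
have -> : mu * (t / 2 / 2) = M / (520 * 256) by rewrite /mu; field; rewrite gt_eqF.
have -> : 520 * (8 * K ^+ 2) * mu ^+ 2 * frobenius_norm A ^+ 2 =
  M / (520 * 512) * (frobenius_norm A ^+ 2 * (K ^+ 2 * M) / t ^+ 2).
  by rewrite /mu; field; rewrite gt_eqF.
have q1 : frobenius_norm A ^+ 2 * (K ^+ 2 * M) / t ^+ 2 <= 1.
  by rewrite ler_pdivrMr ?exprn_gt0// mul1r.
have c1 : 0 < 520 * 512 :> R by exact: mulr_gt0 (ltr0Sn _ _) (ltr0Sn _ _).
have := ler_wpM2l (divr_ge0 (ltW M_gt0) (ltW c1)) q1; rewrite mulr1.
by move: (_ * (_ / t ^+ 2)) => q; lra.
Qed.

End FixedDimension.

(** * Size of the deviation rate and conclusion *)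

Section Asymptotics.
Variable R : realType.

Lemma le_powR_root (r x y : R) : 0 < r -> 0 <= x -> 0 <= y ->
  (y <= x `^ (1 / r)) = (y `^ r <= x).
Proof.
move=> r0 x0 y0.
have xE : (x `^ (1 / r)) `^ r = x by rewrite -powRrM divfK ?gt_eqF// powRr1.
rewrite -[in RHS]xE; apply/idP/idP => h.
  by rewrite ge0_ler_powR ?nnegrE ?powR_ge0// ltW.
rewrite leNgt; apply/negP => yx; move: h; rewrite leNgt => /negP; apply.
by rewrite gt0_ltr_powR ?nnegrE ?powR_ge0.
Qed.

Variables (alpha b : R).
Hypotheses (alpha_gt0 : 0 < alpha) (b_gt0 : 0 < b).

(** Chosen so that [expR (- (b * M / 2))] is at most [n ^- 3] as soon as
    [rate_slope * ln n <= M]. *)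
Definition rate_slope : R := 1 + 6 / b.

(** The hypothesis of growth is used only through this constant: once the
    ratio exceeds it, the deviation rate is at least [rate_slope * ln n]. *)
Definition omega_threshold : R :=
  rate_slope `^ (alpha + 1 / 2) + rate_slope `^ (2 * alpha + 1).

Lemma rate_slope_ge1 : 1 <= rate_slope.
Proof. by rewrite /rate_slope lerDl divr_ge0// ltW. Qed.

Variables (t F S L : R).
Hypotheses (F_gt0 : 0 < F) (S_gt0 : 0 < S) (L_ge1 : 1 <= L).
Hypothesis t_large : omega_threshold <= t / ((F + L `^ alpha * S) * L `^ (alpha + 1)).

Definition deviation_rate : R :=
  Num.min ((t / (F * Num.sqrt L)) `^ (1 / (alpha + 1 / 2)))
          ((t / S) `^ (1 / (2 * alpha + 1))).

Let L_gt0 : 0 < L. Proof. exact: lt_le_trans L_ge1. Qed.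
Let La_gt0 : 0 < L `^ alpha. Proof. exact: powR_gt0. Qed.
Let La1_gt0 : 0 < L `^ (alpha + 1). Proof. exact: powR_gt0. Qed.
Let p_gt0 : 0 < alpha + 1 / 2. Proof. by apply: addr_gt0. Qed.
Let q_gt0 : 0 < 2 * alpha + 1. Proof. by apply: addr_gt0 => //; exact: mulr_gt0. Qed.
Let slope_ge0 : 0 <= rate_slope. Proof. exact: le_trans rate_slope_ge1. Qed.

Let t_bound : omega_threshold * ((F + L `^ alpha * S) * L `^ (alpha + 1)) <= t.
Proof. by rewrite -ler_pdivlMr// mulr_gt0// addr_gt0// mulr_gt0. Qed.

Let threshold_ge0 : 0 <= omega_threshold.
Proof. by rewrite addr_ge0 ?powR_ge0. Qed.

Lemma frobenius_ratio_ge : (rate_slope * L) `^ (alpha + 1 / 2) <= t / (F * Num.sqrt L).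
Proof.
have sL : 0 < Num.sqrt L by rewrite sqrtr_gt0.
rewrite ler_pdivlMr ?mulr_gt0// powRM ?(ltW L_gt0)//.
have LE : L `^ (alpha + 1 / 2) * Num.sqrt L = L `^ (alpha + 1).
  rewrite -powR12_sqrt ?(ltW L_gt0)// -powRD; last by rewrite (gt_eqF L_gt0) implybT.
  by congr (_ `^ _); field.
apply: le_trans t_bound.
rewrite (_ : _ * (F * _) = rate_slope `^ (alpha + 1 / 2) * (F * L `^ (alpha + 1))).
  apply: ler_pM; rewrite ?powR_ge0 ?mulr_ge0 ?(ltW F_gt0) ?powR_ge0//.
    by rewrite lerDl powR_ge0.
  by rewrite ler_wpM2r ?powR_ge0// lerDl mulr_ge0 ?powR_ge0// ltW.
by rewrite -LE; ring.
Qed.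

Lemma spectral_ratio_ge : (rate_slope * L) `^ (2 * alpha + 1) <= t / S.
Proof.
rewrite ler_pdivlMr// powRM ?(ltW L_gt0)//.
have LE : L `^ (2 * alpha + 1) = L `^ alpha * L `^ (alpha + 1).
  rewrite -powRD; last by rewrite (gt_eqF L_gt0) implybT.
  by congr (_ `^ _); ring.
apply: le_trans t_bound.
rewrite [leLHS](_ : _ = rate_slope `^ (2 * alpha + 1) * (L `^ alpha * S * L `^ (alpha + 1))).
  apply: ler_pM; first exact: powR_ge0.
  - by rewrite !mulr_ge0 ?powR_ge0// ltW.
  - by rewrite lerDr powR_ge0.
  - by rewrite ler_wpM2r ?powR_ge0// lerDr ltW.
by rewrite LE; ring.
Qed.

Let t_ge0 : 0 <= t.
Proof. by apply: le_trans t_bound; rewrite !mulr_ge0 ?powR_ge0// addr_ge0 ?mulr_ge0 ?powR_ge0// ltW. Qed.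

Lemma deviation_rate_ge : rate_slope * L <= deviation_rate.
Proof.
have sL : 0 <= rate_slope * L by rewrite mulr_ge0// ltW.
rewrite /deviation_rate le_min; apply/andP; split.
  rewrite le_powR_root//; first exact: frobenius_ratio_ge.
  by rewrite divr_ge0// mulr_ge0 ?sqrtr_ge0// ltW.
rewrite le_powR_root//; first exact: spectral_ratio_ge.
by rewrite divr_ge0// ltW.
Qed.

Lemma deviation_rate_ge1 : 1 <= deviation_rate.
Proof.
apply: le_trans deviation_rate_ge; rewrite -[leLHS]mulr1.
by apply: ler_pM => //; exact: rate_slope_ge1.
Qed.

Lemma deviation_rate_frobenius : deviation_rate `^ (alpha + 1 / 2) * F <= t.
Proof.
have sL : 1 <= Num.sqrt L by rewrite -[leLHS]sqrtr1 ler_sqrt // ltW.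
have h : deviation_rate `^ (alpha + 1 / 2) <= t / (F * Num.sqrt L).
  rewrite -le_powR_root ?divr_ge0 ?mulr_ge0 ?sqrtr_ge0 ?(ltW F_gt0)//.
    by rewrite ge_min lexx.
  exact: le_trans deviation_rate_ge1.
move: h; rewrite ler_pdivlMr; last by rewrite mulr_gt0//; exact: lt_le_trans sL.
apply: le_trans; rewrite ler_wpM2l ?powR_ge0//.
by rewrite ler_peMr// ltW.
Qed.

Lemma deviation_rate_spectral : deviation_rate `^ (2 * alpha + 1) * S <= t.
Proof.
rewrite -ler_pdivlMr// -le_powR_root ?divr_ge0 ?(ltW S_gt0)//.
  by rewrite ge_min lexx orbT.
exact: le_trans deviation_rate_ge1.
Qed.

End Asymptotics.

Theorem corollary1p6 (R : realType) (alpha a b : R) :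
  0 < alpha -> 0 < a -> 0 < b ->
  exists C C' : R, [/\ 0 < C, 0 < C' &
    forall (d : nat -> measure_display)
      (T : forall n : nat, measurableType (d n))
      (P : forall n : nat, probability (T n) R)
      (X : forall n : nat, T n -> 'cV[R[i]]_n)
      (A : forall n : nat, 'M[R[i]]_n)
      (t : nat -> R),
    (forall (n : nat) (i : 'I_n), complex_rv (fun w => X n w i 0)) ->
    (forall n : nat,
      mutually_independent (P n)
        (fun (i : 'I_n) w => complex_pair (X n w i 0))) ->
    (forall (n : nat) (i : 'I_n),
      complex_integrable (P n) (fun w => X n w i 0)) ->
    (forall (n : nat) (i : 'I_n),
      complex_expectation (P n) (fun w => X n w i 0) = 0) ->
    (forall (n : nat) (i : 'I_n),
      complex_variance (P n) (fun w => X n w i 0) = 1%E) ->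
    (forall (n : nat) (i : 'I_n),
      sub_exponential (P n) alpha a b (fun w => X n w i 0)) ->
    (forall n : nat, (0 < n)%N -> A n != 0) ->
    (forall n : nat, (0 < n)%N -> 0 < t n) ->
    little_omega t (fun n =>
      (frobenius_norm (A n) + ln n%:R `^ alpha * spectral_norm (A n))
        * ln n%:R `^ (alpha + 1)) ->
    \forall n \near \oo,
      (P n [set w | (t n <= normc (quadratic_form (A n) (X n w) - \tr (A n)))%R]
        <= (C * expR (- (C' * Num.min
              ((t n / (frobenius_norm (A n) * Num.sqrt (ln n%:R)))
                 `^ (1 / (alpha + 1 / 2)))
              ((t n / spectral_norm (A n)) `^ (1 / (2 * alpha + 1))))))%:E)%E].
Proof.
move=> alpha0 a0 b0.
have c0 : 0 < (520 * 512)^-1 :> R.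
  by rewrite invr_gt0; exact: mulr_gt0 (ltr0Sn _ _) (ltr0Sn _ _).
have b20 : 0 < b / 2 by exact: divr_gt0.
exists (a + 4), (Num.min (b / 2) (520 * 512)^-1); split.
- exact: addr_gt0.
- by rewrite lt_min b20 c0.
move=> d T P X A t mX indX intX meanX varX tailX A0 t0 omega.
near=> n.
have n_gt0 : (0 < n)%N by near: n; exact: nbhs_infty_gt.
have n_e : expR 1 <= n%:R :> R by near: n; exact: nbhs_infty_ger.
have n_tail : 60 * tail_const alpha a b <= n%:R by near: n; exact: nbhs_infty_ger.
have ratio : omega_threshold alpha b <= t n /
   ((frobenius_norm (A n) + ln n%:R `^ alpha * spectral_norm (A n)) * ln n%:R `^ (alpha + 1)).
  near: n; move/cvgryPge : omega; exact.
have nR : 0 < n%:R :> R by rewrite ltr0n.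
have L1 : 1 <= ln (n%:R : R) by rewrite -[leLHS]expRK ler_ln ?posrE ?expR_gt0.
have [S0 F0] := norms_gt0 (A0 n n_gt0).
rewrite -/(deviation_rate alpha (t n) (frobenius_norm (A n)) (spectral_norm (A n)) (ln n%:R)).
set M := deviation_rate _ _ _ _ _.
have ML : rate_slope b * ln n%:R <= M by exact: deviation_rate_ge.
have M1 : 1 <= M by exact: deviation_rate_ge1 ratio.
have M0 : 0 <= M by exact: le_trans M1.
(* absorbs every polynomial factor in the dimension *)
have n3 : n%:R ^+ 3 * expR (- (b * M / 2)) <= 1.
  rewrite -[n%:R]lnK ?posrE// -expRM_natl -expRD -[leRHS]expR0 ler_expR.
  have : b * (rate_slope b * ln n%:R) <= b * M by rewrite ler_pM2l.
  have -> : b * (rate_slope b * ln n%:R) = (b + 6) * ln n%:R.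
    by rewrite /rate_slope; field; rewrite gt_eqF.
  have : 0 <= b * ln n%:R by rewrite mulr_ge0 ?ltW// (lt_le_trans _ L1).
  by rewrite mulrDl; lra.
set E2 := expR (- (b * M / 2)) in n3.
have E20 : 0 <= E2 by exact: expR_ge0.
have n1 : 1 <= n%:R :> R by rewrite ler1n.
have large : 60 * n%:R ^+ 2 * (tail_const alpha a b * E2) <= 1.
  apply: le_trans n3.
  have -> : 60 * n%:R ^+ 2 * (tail_const alpha a b * E2) =
    (60 * tail_const alpha a b) * (n%:R ^+ 2 * E2) by ring.
  have -> : n%:R ^+ 3 * E2 = n%:R * (n%:R ^+ 2 * E2) by ring.
  by rewrite ler_wpM2r// mulr_ge0// exprn_ge0.
apply: le_trans (quadratic_form_tail alpha0 a0 b0 n_gt0 (mX n) (indX n) (intX n)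
  (meanX n) (varX n) (tailX n) (t0 n n_gt0) M1 _ _ large) _.
- exact: deviation_rate_spectral ratio.
- exact: deviation_rate_frobenius ratio.
rewrite lee_fin [leRHS]mulrDl; apply: lerD.
  have -> : - (b * M) = - (b * M / 2) + - (b * M / 2) by field.
  rewrite expRD -/E2 mulrCA ler_wpM2l ?(ltW a0)// mulrA.
  apply: (@le_trans _ _ (1 * E2)).
    apply: ler_wpM2r => //; apply: le_trans n3; rewrite ler_wpM2r//.
    by rewrite -[leLHS]expr1 ler_weXn2l.
  rewrite mul1r ler_expR lerN2 [leRHS]mulrAC ler_wpM2r//.
  by rewrite ge_min lexx.
rewrite ler_pM2l// ler_expR lerN2 [leRHS]mulrC ler_wpM2r//.
by rewrite ge_min lexx orbT.
Unshelve. all: by end_near.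
Qed.
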